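(* Let $d=1$ and let $X$ be the solution on $[0,T]$ of $$X_t=X_0+\int_0^tb(X_s)\,ds+aB_t+\int_0^t\int_{\mathbb{R}\setminus\{0\}}\gamma z\,(\nu(ds,dz)-F(z)\,dz\,ds),$$ with $a,\gamma$ real constants. Suppose that Assumptions A1–A5 (listed in the context) hold, that $\int_{\mathbb{R}}F(z)\,dz<\infty$ and that $\mu_b\in\mathcal{H}_1(\beta,\mathcal{L})$ with $\beta\ge1$, $\mathcal{L}>0$. Then there exist $T_0>0$ and $c>0$ such that, for all $T\ge T_0$, $$\inf_{x\in\mathbb{R}}\mathcal{R}^x_T(\beta,\mathcal{L})\ge\frac cT,$$ where $$\mathcal{R}^x_T(\beta,\mathcal{L}):=\inf_{\tilde\mu_T}\ \sup_{b\in\Sigma(\beta,\mathcal{L})}\mathbb{E}_b^{(T)}\left[(\tilde\mu_T(x)-\mu_b(x))^2\right],$$ the infimum being over all possible estimators $\tilde\mu_T$ of the invariant density based on the observation of $(X_t)_{t\in[0,T]}$.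
   Context: $B$ is a standard Brownian motion, $\nu$ is a Poisson random measure on $\mathbb{R}_+\times\mathbb{R}$ with intensity $F(z)\,dz\,ds$ associated to a Lévy process with Lévy density $F$; $X_0$, $B$, $\nu$ are mutually independent. Assumptions (for constant $a,\gamma$, $d=1$): - A1: $b:\mathbb{R}\to\mathbb{R}$ is globally Lipschitz and bounded; $a\neq0$ and $\gamma>0$. - A2: there are $\rho,c_1,c_2>0$ such that $x\,b(x)\le-c_1|x|+c_2$ for all $|x|\ge\rho$. - A3: $\mathrm{Supp}(F)=\mathbb{R}\setminus\{0\}$ and, for some $\alpha\in(0,2)$, $c_3>0$, $F(z)\le\frac{c_3}{|z|^{1+\alpha}}$ for all $z\ne0$. - A4: there are $\epsilon_0>0$, $c_4>0$ such that $\int_{\mathbb{R}\setminus\{0\}}|z|^2e^{\epsilon_0|z|}F(z)\,dz\le c_4$. - A5: if $\alpha=1$, then $\int_{r<|z|<R}zF(z)\,dz=0$ for all $0<r<R<\infty$. Under these assumptions the solution has a unique invariant distribution, assumed to have a density $\mu_b$ with respect to Lebesgue measure, and the process is stationary (i.e. $X_0$ has density $\mu_b$). $\mathbb{E}_b^{(T)}$ denotes expectation under the law $\mathbb{P}_b^{(T)}$ of the solution $(X_t)_{t\in[0,T]}$ with drift $b$. Hölder class: $\mu\in\mathcal{H}_1(\beta,\mathcal{L})$ means that for all $k=0,1,\dots,\lfloor\beta\rfloor$ ($\lfloor\beta\rfloor$ the integer part of $\beta$) and all $t\in\mathbb{R}$, $\|\mu^{(k)}\|_\infty\le\mathcal{L}$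 and $\|\mu^{(\lfloor\beta\rfloor)}(\cdot+t)-\mu^{(\lfloor\beta\rfloor)}(\cdot)\|_\infty\le\mathcal{L}|t|^{\beta-\lfloor\beta\rfloor}$. $\Sigma(\beta,\mathcal{L})$ is the set of bounded Lipschitz functions $b:\mathbb{R}\to\mathbb{R}$ satisfying A2 such that the unique invariant density $\mu_b$ of the solution of the equation $$X_t=X_0+\int_0^tb(X_s)\,ds+aB_t+\int_0^t\int_{\mathbb{R}\setminus\{0\}}\gamma z\,(\nu(ds,dz)-F(z)\,dz\,ds)$$ with drift $b$ (the parameters $a,\gamma,F$ being fixed) belongs to $\mathcal{H}_1(\beta,2\mathcal{L})$. *)

(* Defs.v *)
From HB Require Import structures.
From mathcomp Require Import all_boot all_order all_algebra.
From mathcomp Require Import all_classical all_reals all_analysis.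
From mathcomp Require Import measurable_realfun.
Set Implicit Arguments.
Unset Strict Implicit.
Unset Printing Implicit Defensive.
Import Order.TTheory GRing.Theory Num.Theory.
Import numFieldNormedType.Exports.
Local Open Scope classical_set_scope.
Local Open Scope ring_scope.

Section probability_notions.
Context {d d' : measure_display} {Om : measurableType d}
  {S : measurableType d'} {R : realType}.

Definition mutually_independent (P : probability Om R) (I : finType)
    (Y : I -> Om -> S) : Prop :=
  forall A : I -> set S, (forall i, measurable (A i)) ->
    P (\bigcap_i (Y i @^-1` A i)) = (\prod_i P (Y i @^-1` A i))%E.

End probability_notions.

Definition sigma_family {aT I : Type} {d : measure_display}
    {S : measurableType d} (D : set I) (Y : I -> aT -> S) : set (set aT) :=
  <<s \bigcup_(i in D) preimage_set_system setT (Y i) measurable >>.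

Definition independent3 {d : measure_display} {Om : measurableType d}
    {R : realType} (P : probability Om R) (G1 G2 G3 : set (set Om)) : Prop :=
  forall A1 A2 A3, G1 A1 -> G2 A2 -> G3 A3 ->
    P (A1 `&` A2 `&` A3) = (P A1 * P A2 * P A3)%E.

(* Only times t >= 0 are meaningful: paths and processes are total functions of
   t : R whose values at t < 0 are never constrained nor observed. *)
Definition cadlag {R : realType} : set (R -> R) :=
  [set w : R -> R | (forall t : R, 0 <= t -> w @ t^'+ --> w t) /\
           (forall t : R, 0 < t -> cvg (w @ t^'-))].

Definition cadlag_path (R : realType) : Type := set_type (@cadlag R).

Definition path_at {R : realType} (t : R) (w : cadlag_path R) : R := set_val w t.

Lemma cadlag_cst0 (R : realType) : (fun _ : R => 0 : R) \in @cadlag R.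
Proof.
by apply/mem_set; split => t _; [exact: cvg_cst | exact: is_cvg_cst].
Qed.

HB.instance Definition _ (R : realType) :=
  Choice.copy (cadlag_path R) (set_type (@cadlag R)).
HB.instance Definition _ (R : realType) :=
  isPointed.Build (cadlag_path R) (SigSub (cadlag_cst0 R)).

(* Only the coordinates in [0, T] generate the sigma-algebra, so measurable maps
   out of this type are exactly the functionals of (w_t)_{t in [0, T]}. *)
Definition observed_path (R : realType) (T : R) :=
  g_sigma_algebraType
    (sigma_family [set t | 0 <= t <= T] (@path_at R)).

Definition brownian_motion {d : measure_display} {Om : measurableType d}
    {R : realType} (P : probability Om R) (B : R -> Om -> R) : Prop :=
  [/\ forall t, 0 <= t -> measurable_fun setT (B t),
      {ae P, forall w, B 0 w = 0},
      {ae P, forall w, {within [set t | 0 <= t], continuous (B ^~ w)}},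
      forall s t, 0 <= s -> s < t -> forall A : set R, measurable A ->
        P [set w | A (B t w - B s w)] = normal_prob 0 (Num.sqrt (t - s)) A &
      forall (n : nat) (t : nat -> R), 0 <= t 0%N ->
        (forall i, t i <= t i.+1) ->
        mutually_independent P
          (fun (i : 'I_n) w => B (t i.+1) w - B (t i) w)].

Section jump_diffusion.
Context {R : realType}.
Local Notation leb := (@lebesgue_measure R).
Local Notation R0 := [set z : R | z != 0].

Definition levy_density (F : R -> R) : Prop :=
  [/\ measurable_fun setT F, forall z, z != 0 -> 0 <= F z &
      (\int[leb]_(z in R0) (Num.min 1 (z ^+ 2) * F z)%:E < +oo)%E].

(* F(z) dz ds on R_+ x (R \ {0}), seen as a measure on the plane; the first
   coordinate is the time, the second one is the jump size. *)
Definition jump_intensity (F : R -> R) (A : set (R * R)) : \bar R :=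
  (\int[leb \x leb]_(p in A `&` [set p : R * R | (0 <= p.1)%R /\ p.2 != 0%R])
     (F p.2)%:E)%E.

Definition poisson_random_measure {d : measure_display}
    {Om : measurableType d} (P : probability Om R) (F : R -> R)
    (nu : Om -> {measure set (R * R) -> \bar R}) : Prop :=
  [/\ forall A, measurable A -> measurable_fun setT (fun w => nu w A),
      forall A lam, measurable A -> jump_intensity F A = lam%:E ->
        forall k : nat,
          P [set w | nu w A = k%:R%:E] = poisson_prob lam k [set k] &
      forall (n : nat) (A : 'I_n -> set (R * R)),
        (forall i, measurable (A i)) -> trivIset setT A ->
        mutually_independent P (fun i w => nu w (A i))].

(* When F is integrable, nu has a.s. finitely many atoms in `]0, t] x R, so that
   the integral of gamma * z against nu(ds, dz) - F(z) dz ds is the pathwise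
   difference of two Lebesgue integrals. *)
Definition compensated_jumps (gamma : R) (F : R -> R)
    (N : {measure set (R * R) -> \bar R}) (t : R) : R :=
  \int[N]_(p in `]0, t] `*` R0) (gamma * p.2)
  - \int[leb]_(s in `]0, t]) \int[leb]_(z in R0) (gamma * z * F z).

(* The noise being additive, no stochastic integral and no filtration is needed:
   the equation holds path by path. *)
Definition solution (a gamma : R) (F b : R -> R)
    {d : measure_display} {Om : measurableType d} (P : probability Om R)
    (B : R -> Om -> R) (nu : Om -> {measure set (R * R) -> \bar R})
    (X : Om -> cadlag_path R) : Prop :=
  [/\ brownian_motion P B,
      poisson_random_measure P F nu,
      forall t, 0 <= t -> measurable_fun setT (fun w => path_at t (X w)),
      independent3 P
        (sigma_family [set 0] (fun t w => path_at t (X w)))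
        (sigma_family [set t | 0 <= t] B)
        (sigma_family measurable (fun A w => nu w A)) &
      {ae P, forall w, forall t, 0 <= t ->
        path_at t (X w) = path_at 0 (X w)
          + \int[leb]_(s in `[0, t]) b (path_at s (X w))
          + a * B t w + compensated_jumps gamma F (nu w) t}].

Definition has_density (pi : set R -> \bar R) (m : R -> R) : Prop :=
  [/\ measurable_fun setT m, forall x, 0 <= m x &
      forall A, measurable A -> pi A = (\int[leb]_(x in A) (m x)%:E)%E].

Definition marginal {d : measure_display} {Om : measurableType d}
    (P : probability Om R) (X : Om -> cadlag_path R) (t : R) :
    set R -> \bar R :=
  fun A => P [set w | A (path_at t (X w))].

(* pi is invariant when X_0 ~ pi forces X_t ~ pi for all t, whatever the
   stochastic basis carrying the solution. *)
Definition invariant_distribution (a gamma : R) (F b : R -> R)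
    (pi : probability R R) : Prop :=
  forall (d : measure_display) (Om : measurableType d) (P : probability Om R)
    (B : R -> Om -> R) (nu : Om -> {measure set (R * R) -> \bar R})
    (X : Om -> cadlag_path R),
    solution a gamma F b P B nu X ->
    (forall A, measurable A -> marginal P X 0 A = pi A) ->
    forall t, 0 <= t -> forall A, measurable A -> marginal P X t A = pi A.

Definition unique_invariant_density (a gamma : R) (F b m : R -> R) : Prop :=
  exists pi : probability R R,
    [/\ invariant_distribution a gamma F b pi,
        forall pi' : probability R R, invariant_distribution a gamma F b pi' ->
          forall A, measurable A -> pi' A = pi A &
        has_density pi m].

Definition holder_class (beta L : R) (m : R -> R) : Prop :=
  let n := Num.truncn beta in
  [/\ forall k x, (k < n)%N -> derivable (derive1n k m) x 1,
      forall k x, (k <= n)%N -> `|derive1n k m x| <= L &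
      forall t x, `|derive1n n m (x + t) - derive1n n m x|
                    <= L * `|t| `^ (beta - n%:R)].

Definition mean_reverting (b : R -> R) : Prop :=
  exists rho c1 c2 : R, [/\ 0 < rho, 0 < c1, 0 < c2 &
    forall x, rho <= `|x| -> x * b x <= - c1 * `|x| + c2].

(* F lives on R \ {0}: its support is the closure of {F <> 0} relative to
   R \ {0}. *)
Definition full_support (F : R -> R) : Prop :=
  closure [set z | z != 0 /\ F z != 0] `&` R0 = R0.

Definition stable_domination (alpha : R) (F : R -> R) : Prop :=
  exists2 c3 : R, 0 < c3 &
    forall z, z != 0 -> F z <= c3 / `|z| `^ (1 + alpha).

Definition exponential_moment (F : R -> R) : Prop :=
  exists eps0 c4 : R, [/\ 0 < eps0, 0 < c4 &
    (\int[leb]_(z in R0) (`|z| ^+ 2 * expR (eps0 * `|z|) * F z)%:E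
       <= c4%:E)%E].

Definition centered_annuli (F : R -> R) : Prop :=
  forall r r' : R, 0 < r -> r < r' ->
    (\int[leb]_(z in [set z : R | (r < `|z| < r')%R]) (z * F z)%:E = 0)%E.

(* b belongs to the class Sigma(beta, L) and m is its invariant density mu_b. For
   1 <= beta the last condition selects the continuous version of the density,
   so m is determined pointwise by b. *)
Definition drift_class (a gamma : R) (F : R -> R) (beta L : R)
    (b m : R -> R) : Prop :=
  [/\ bounded_fun b, lipschitz b, mean_reverting b,
      unique_invariant_density a gamma F b m & holder_class beta (2 * L) m].

(* Q is the law on [0, T] of the solution with drift b and X_0 ~ m(x) dx. *)
Definition stationary_law (a gamma : R) (F b m : R -> R) (T : R)
    (Q : probability (observed_path T) R) : Prop :=
  exists (d : measure_display) (Om : measurableType d) (P : probability Om R)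
    (B : R -> Om -> R) (nu : Om -> {measure set (R * R) -> \bar R})
    (X : Om -> cadlag_path R),
    [/\ solution a gamma F b P B nu X,
        has_density (marginal P X 0) m &
        forall C : set (observed_path T), measurable C -> Q C = P (X @^-1` C)].

Definition minimax_risk (a gamma : R) (F : R -> R) (beta L T x : R) : \bar R :=
  ereal_inf
    [set ereal_sup
      [set r | exists (b m : R -> R) (Q : probability (observed_path T) R),
        [/\ drift_class a gamma F beta L b m,
            stationary_law a gamma F b m Q &
            r = (\int[Q]_w ((est w - m x) ^+ 2)%:E)%E]]
    | est in [set est : observed_path T -> R | measurable_fun setT est]].

End jump_diffusion.

(* Main.v *)
Require Import Defs.
From HB Require Import structures.
From mathcomp Require Import all_boot all_order all_algebra.
From mathcomp Require Import all_classical all_reals all_analysis.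
From mathcomp Require Import measurable_realfun ring lra.
Set Implicit Arguments.
Unset Strict Implicit.
Unset Printing Implicit Defensive.
Import Order.TTheory GRing.Theory Num.Theory.
Import numFieldNormedType.Exports.
Local Open Scope classical_set_scope.
Local Open Scope ring_scope.

(** The noise is additive, so a stationary solution translated by [c] is a
stationary solution, with drift and invariant density translated by [c]. All the
conditions that define the class of drifts are invariant under translation
([drift_class_translation]); the class thus contains the translates of the given
drift, and the lower bound is obtained from two of them. Translating also moves
the point at which the density is estimated, which is why the bound is uniform
in that point.

A probability density on the line is not constant, so the slope of [mu] at some
[y] is nonzero ([nonconstant_density]). For a given [x], the first hypothesis is
the translate that brings [y] to [x], and the second one is translated further by
[h = 1 / sqrt T]. Their densities at [x] differ by at least a multiple of [h], so
that Le Cam's two-point argument ([two_point_bound]) gives a risk of order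
[h ^+ 2 = 1 / T], as long as the laws of the two observed paths are not too far
apart. The measure of this is [law_comparison]: an event has probability at most
[3 / 8 + C * p] under the second law if it has probability [p] under the first,
where [C] does not depend on [T] because [h ^+ 2 * T = 1].

This comparison is a form of Girsanov's theorem, obtained without stochastic
integrals from the Euler scheme. Two things change between the hypotheses. The
starting point is translated by [h], which costs the total variation distance
between [mu] and its translate; it tends to 0 with [h] ([integral_initial_shift],
[shift_loss_small]). The drift changes by at most [K * h], where [K] is its
Lipschitz constant. Once the starting point and the jumps are frozen, the steps of
the scheme are Gaussian, and the drift is exchanged one step at a time at the price
of an explicit likelihood ratio, whose second moment is at most
[expR ((K * h / a) ^+ 2 * T)] whatever the mesh ([change_of_drift]).

The scheme converges to the solution at each time ([cvg_euler]), so the comparison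
passes to continuous functionals of finitely many coordinates
([cylinder_inequality]). Such functionals approximate in L1 every event of the
observed sigma-algebra ([cylinder_transfer]). *)

(** * Laws, densities and translations *)

Definition mfun_of d d' (T : measurableType d) (T' : measurableType d')
    (f : T -> T') (mf : measurable_fun setT f) : {mfun T >-> T'} :=
  HB.pack f (isMeasurableFun.Build _ _ _ _ f mf).

Definition law d d' (T : measurableType d) (T' : measurableType d')
    (R : realType) (P : probability T R) (f : T -> T')
    (mf : measurable_fun setT f) : probability T' R :=
  distribution P (mfun_of mf).

Lemma lawE d d' (T : measurableType d) (T' : measurableType d')
    (R : realType) (P : probability T R) (f : T -> T')
    (mf : measurable_fun setT f) A : law P mf A = P (f @^-1` A).
Proof. by []. Qed.

Lemma ge0_integral_law d d' (T : measurableType d) (T' : measurableType d')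
    (R : realType) (P : probability T R) (f : T -> T')
    (mf : measurable_fun setT f) (g : T' -> \bar R) :
  measurable_fun setT g -> (forall y, (0 <= g y)%E) ->
  (\int[law P mf]_y g y = \int[P]_x g (f x))%E.
Proof. by move=> mg g0; rewrite ge0_integral_distribution. Qed.

(** Two densities of the same finite measure agree almost everywhere, so [m] may
replace the Radon-Nikodym derivative in the change of variables formula. *)
Lemma ge0_integral_density d (T : measurableType d) (R : realType)
    (pi : probability T R) (mu : {sigma_finite_measure set T -> \bar R})
    (m : T -> R) (f : T -> \bar R) :
  measurable_fun setT m -> (forall x, 0 <= m x) ->
  (forall A, measurable A -> pi A = (\int[mu]_(x in A) (m x)%:E)%E) ->
  measurable_fun setT f -> (forall x, (0 <= f x)%E) ->
  (\int[pi]_x f x = \int[mu]_x (f x * (m x)%:E))%E.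
Proof.
move=> mm m0 piE mf f0.
have im : mu.-integrable setT (EFin \o m).
  apply/integrableP; split; first exact/measurable_EFinP.
  rewrite (eq_integral (EFin \o m)); last first.
    by move=> x _ /=; rewrite ger0_norm.
  by rewrite -piE// probability_setT ltry.
have pimu : pi `<< mu.
  apply/null_content_dominatesP => A mA muA0; rewrite piE//.
  apply: null_set_integral => //.
  by apply/measurable_EFinP; exact: measurable_funTS.
rewrite -(@Radon_Nikodym_SigmaFinite.change_of_variables _ _ _ pi mu)//.
apply: ae_eq_integral => //.
- apply: emeasurable_funM => //.
  exact: measurable_int (Radon_Nikodym_SigmaFinite.f_integrable _).
- by apply: emeasurable_funM => //; exact/measurable_EFinP.
- apply: ae_eqe_mul2l; apply: integral_ae_eq => //.
  + exact: Radon_Nikodym_SigmaFinite.f_integrable.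
  + exact/measurable_EFinP.
  + by move=> A _ mA; rewrite -Radon_Nikodym_SigmaFinite.f_integral//; exact: piE.
Qed.

Section translation.
Context {R : realType}.
Local Notation leb := (@lebesgue_measure R).

Lemma measurable_addr (h : R) : measurable_fun setT (fun x : R => x + h).
Proof. by apply: measurable_funD => //; exact: measurable_cst. Qed.

(** A translation preserves the length of half-open intervals, and these
determine the measure. *)
Lemma lebesgue_translation (h : R) (A : set R) : measurable A ->
  leb A = leb ((fun x => x + h) @^-1` A).
Proof.
move=> mA; have mh := measurable_addr h.
rewrite -[RHS]/(pushforward leb (fun x => x + h) A).
apply: (@lebesgue_measure_unique _
  (pushforward leb (fun x : measurableTypeR R => x + h : measurableTypeR R))) => //.
move=> X /ocitvP[->|]; first by rewrite !measure0.
move=> [[a b] /= ab ->]; rewrite /pushforward/=.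
have -> : (fun x => x + h) @^-1` `]a, b]%classic = `]a - h, b - h]%classic.
  apply/seteqP; split => x /=; rewrite !in_itv/= => /andP[? ?]; apply/andP; split; lra.
rewrite !lebesgue_measure_itv/= !lte_fin ltrD2r ab -!EFinD; congr (_%:E); ring.
Qed.

Lemma ge0_integral_translation (h : R) (f : R -> \bar R) :
  measurable_fun setT f -> (forall x, (0 <= f x)%E) ->
  (\int[leb]_x f (x + h)%R = \int[leb]_x f x)%E.
Proof.
move=> mf f0; have mh := measurable_addr h.
have := @ge0_integral_pushforward _ _ (measurableTypeR R) (measurableTypeR R) R
  (fun x : R => x + h) mh leb setT f
  measurableT mf (fun x _ => f0 x).
rewrite preimage_setT => <-.
by apply: eq_measure_integral => A mA _; exact/esym/lebesgue_translation.
Qed.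

End translation.

Section gaussian_shift.
Context {R : realType}.

(** One-dimensional Cameron-Martin formula: completing the square in the Gaussian
density trades a translation by [th * s ^+ 2] for an exponential weight. *)
Lemma normal_shift (s th : R) (f : R -> \bar R) : 0 < s ->
  measurable_fun setT f -> (forall x, (0 <= f x)%E) ->
  (\int[normal_prob 0%R s]_x f (x + th * s ^+ 2)%R
   = \int[normal_prob 0%R s]_x (f x * (expR (th * x - th ^+ 2 * s ^+ 2 / 2))%:E))%E.
Proof.
move=> s0 mf f0.
have dens g : measurable_fun setT g -> (forall x, (0 <= g x)%E) ->
    (\int[normal_prob 0%R s]_x g x
     = \int[lebesgue_measure]_x (g x * (normal_pdf 0 s x)%:E))%E.
  move=> mg g0; apply: ge0_integral_density => //.
  - exact: measurable_normal_pdf.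
  - by move=> x; exact: normal_pdf_ge0.
have mh := measurable_addr (th * s ^+ 2).
have mE : measurable_fun setT (fun x : R => expR (th * x - th ^+ 2 * s ^+ 2 / 2)).
  apply: measurableT_comp => //; apply: measurable_funD => //.
rewrite dens//; last exact: (measurableT_comp mf mh).
rewrite dens//; last 2 first.
- by apply: emeasurable_funM => //; exact/measurable_EFinP.
- by move=> x; rewrite mule_ge0// lee_fin expR_ge0.
rewrite -[RHS](ge0_integral_translation (th * s ^+ 2)); last 2 first.
- apply: emeasurable_funM.
    by apply: emeasurable_funM => //; exact/measurable_EFinP.
  by apply/measurable_EFinP; exact: measurable_normal_pdf.
- by move=> x; rewrite !mule_ge0// lee_fin ?expR_ge0 ?normal_pdf_ge0.
apply: eq_integral => x _; rewrite -muleA -EFinM; congr (_ * _%:E)%E.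
rewrite !normal_pdfE ?gt_eqF// mulrCA; congr *%R.
rewrite /normal_fun -expRD; congr expR.
have s00 : s != 0 by rewrite gt_eqF.
by field.
Qed.

End gaussian_shift.

(** * Freezing an independent variable *)

Section freezing.
Context d (Om : measurableType d) (R : realType) (P : probability Om R).
Context d' (T : measurableType d') (G : set (set Om)) (xi : Om -> T)
  (pi : probability T R).
Hypotheses (Gm : forall A, G A -> measurable A) (GI : setI_closed G)
  (GT : G setT) (mxi : measurable_fun setT xi).
Hypothesis indep : forall A B, G A -> measurable B ->
  P (A `&` xi @^-1` B) = (P A * pi B)%E.

Local Notation gOm := (g_sigma_algebraType G).

Lemma g_sigma_sub (A : set Om) : <<s G >> A -> measurable A.
Proof.
apply: smallest_sub => //; exact: sigma_algebra_measurable.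
Qed.

Lemma measurable_to_g_sigma d2 (T2 : measurableType d2) (f : gOm -> T2) :
  measurable_fun setT f -> measurable_fun setT (f : Om -> T2).
Proof.
by move=> mf _ B mB; apply: g_sigma_sub; exact: (mf measurableT).
Qed.

(** Both sides are finite measures in [A] that agree on the pi-system [G]. *)
Lemma indep_g_sigma A B : <<s G >> A -> measurable B ->
  P (A `&` xi @^-1` B) = (P A * pi B)%E.
Proof.
move=> sA mB.
have mxB : measurable (xi @^-1` B) by rewrite -[X in measurable X]setTI; exact: mxi.
have piB0 : 0 <= fine (pi B) by rewrite fine_ge0.
have piBE : pi B = (fine (pi B))%:E by rewrite fineK// fin_num_measure.
rewrite muleC piBE.
apply: (@g_sigma_algebra_measure_unique _ _ _ G Gm (fun=> setT) _ _
  (mrestr P mxB) (mscale (NngNum piB0) P)) => //.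
- by apply/seteqP; split => // x _; exists 0%N.
- by move=> C GC; rewrite /= /mrestr /mscale/= -piBE indep// muleC.
- move=> k; rewrite /mrestr.
  by rewrite (le_lt_trans (probability_le1 _ _)) ?ltry//; exact: measurableI.
Qed.

(** By independence the joint law of [xi] and of the identity, the latter seen
through [<<s G>>], is a product measure, and Tonelli's theorem applies.
Freezing a sigma-algebra rather than a random vector dispenses with a value space
for the variables that are kept fixed. *)
Lemma integral_freezing (f : gOm * T -> \bar R) :
  measurable_fun setT f -> (forall p, (0 <= f p)%E) ->
  (\int[P]_w f (w, xi w) = \int[P]_w \int[pi]_x f (w, x))%E.
Proof.
move=> mf f0.
have mid : measurable_fun setT (id : Om -> gOm).
  by move=> _ B mB; rewrite setTI; exact: g_sigma_sub.
have mPhi : measurable_fun setT (fun w => (w, xi w) : gOm * T).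
  exact: measurable_fun_pair.
pose PG := law P mid.
pose PJ := law P mPhi.
have prodE X : measurable X -> (PG \x pi)%E X = PJ X.
  apply: product_measure_unique => A B mA mB.
  exact: indep_g_sigma.
transitivity (\int[PJ]_p f p)%E; first exact/esym/ge0_integral_law.
transitivity (\int[(PG \x pi)%E]_p f p)%E.
  by apply: eq_measure_integral => A mA _; exact/esym/prodE.
rewrite fubini_tonelli1//.
have mF := @measurable_fun_fubini_tonelli_F _ _ _ _ _ pi f mf f0.
transitivity (\int[PG]_w \int[pi]_y f (w, y))%E => //.
by apply: ge0_integral_law => // w; exact: integral_ge0.
Qed.

End freezing.

(** * Changing the drift of a Gaussian chain *)

Section chain.
Context {R : realType}.

(** The drift step [dr] depends on the time index, so that a chain may change its
drift half-way. *)
Fixpoint chain (dr : nat -> R -> R) (z : nat -> R) (u : R) (i : nat) : R :=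
  if i is j.+1 then chain dr z u j + dr j (chain dr z u j) + z j else u.

Lemma measurable_chain d (S : measurableType d) (dr : nat -> R -> R)
    (z : nat -> S -> R) (u : S -> R) i :
  (forall j, measurable_fun setT (dr j)) ->
  (forall j, measurable_fun setT (z j)) -> measurable_fun setT u ->
  measurable_fun setT (fun w => chain dr (z ^~ w) (u w) i).
Proof.
move=> mdr mz mu; elim: i => //= i ih.
apply: measurable_funD => //; apply: measurable_funD => //.
exact: (measurableT_comp (mdr i) ih).
Qed.

Lemma eq_chain dr dr' z z' u i :
  (forall j x, (j < i)%N -> dr j x = dr' j x) ->
  (forall j, (j < i)%N -> z j = z' j) ->
  chain dr z u i = chain dr' z' u i.
Proof.
elim: i => //= i ih edr ez.
by rewrite ih ?edr ?ez// => j *; [apply: edr|apply: ez]; rewrite ltnW.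
Qed.

Lemma chain_translation dr h z u i :
  chain (fun j x => dr j (x - h)) z (u + h) i = chain dr z u i + h.
Proof. by elim: i => //= i ->; rewrite addrK; ring. Qed.

End chain.

(** Measurability on sequences, stated through composition with measurable
coordinates so that no sigma-algebra on [nat -> R] has to be chosen. *)
Definition pathwise_measurable {R : realType} (Psi : (nat -> R) -> R) :=
  forall d (S : measurableType d) (e : nat -> S -> R),
    (forall i, measurable_fun setT (e i)) ->
    measurable_fun setT (fun w => Psi (e ^~ w)).

Section change_of_drift.
Context d (Om : measurableType d) (R : realType) (P : probability Om R).
Variables (a s kappa : R) (f0 f1 th : R -> R) (n : nat)
  (xi V : nat -> Om -> R) (U : Om -> R) (G : nat -> set (set Om)).
(* Passing from [f0] to [f1] shifts the Gaussian variable [xi k] by [th] times its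
   variance [s ^+ 2]; [V] is the noise left untouched. *)
Hypotheses (s0 : 0 < s) (mf0 : measurable_fun setT f0)
  (mth : measurable_fun setT th)
  (f1E : forall x, f1 x = f0 x + a * (th x * s ^+ 2))
  (th_bnd : forall x, `|th x| <= kappa).
(* [G k] stands for all the randomness except the variable [xi k]. *)
Hypotheses
  (Gm : forall k A, G k A -> measurable A)
  (GI : forall k, setI_closed (G k))
  (GT : forall k, G k setT)
  (mxi : forall k, measurable_fun setT (xi k))
  (indep : forall k A B, (k < n)%N -> G k A -> measurable B ->
     P (A `&` xi k @^-1` B) = (P A * normal_prob 0 s B)%E)
  (mUG : forall k, measurable_fun setT (U : g_sigma_algebraType (G k) -> R))
  (mVG : forall k j, measurable_fun setT (V j : g_sigma_algebraType (G k) -> R))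
  (mxiG : forall k j, j != k ->
     measurable_fun setT (xi j : g_sigma_algebraType (G k) -> R)).

Let mf1 : measurable_fun setT f1.
Proof.
rewrite (_ : f1 = fun x => f0 x + a * (th x * s ^+ 2)); last exact/funext.
apply: measurable_funD => //; apply: measurable_funM => //.
exact: measurable_funM.
Qed.

(** Hybrids interpolate between the two drifts, so that these can be exchanged one
step at a time. *)
Definition hybrid (k j : nat) : R -> R := if (j < k)%N then f0 else f1.

Let mhybrid k j : measurable_fun setT (hybrid k j).
Proof. by rewrite /hybrid; case: ifP. Qed.

Definition noisy (x v : nat -> R) (j : nat) : R := a * x j + v j.

Definition hybrid_chain k (x v : nat -> R) (u : R) (i : nat) : R :=
  chain (hybrid k) (noisy x v) u i.

(** Density ratio, at the value [x k], between the k-th Gaussian variable shifted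
by [t * s ^+ 2] and the unshifted one. *)
Definition tilt k (x v : nat -> R) (u : R) : R :=
  let t := th (hybrid_chain k x v u k) in expR (t * x k - t ^+ 2 * s ^+ 2 / 2).

(** Likelihood ratio of the first [k] steps: drift [f1] against drift [f0]. *)
Definition weight k (x v : nat -> R) (u : R) : R :=
  \prod_(j < k) tilt j x v u.

Definition subst_at (k : nat) (y : R) (x : nat -> R) (j : nat) : R :=
  if j == k then y else x j.

Lemma subst_at_id k x : subst_at k (x k) x = x.
Proof. by apply/funext => j; rewrite /subst_at; case: eqP => [->|]. Qed.

Lemma hybrid_chain_subst k m y x v u i : (i <= k)%N ->
  hybrid_chain m (subst_at k y x) v u i = hybrid_chain m x v u i.
Proof.
move=> ik; apply: eq_chain => // j ji; rewrite /noisy /subst_at.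
by rewrite ltn_eqF// (leq_trans ji).
Qed.

Lemma weight_subst k y x v u : weight k (subst_at k y x) v u = weight k x v u.
Proof.
apply: eq_bigr => -[j jk] _ /=; rewrite /tilt hybrid_chain_subst; last exact: ltnW.
by rewrite /subst_at ltn_eqF.
Qed.

(** Replacing [f0] by [f1] at step [k] has the same effect as shifting the k-th
Gaussian variable, by the relation between [f0], [f1] and [th]. *)
Lemma hybrid_chainS_subst k y x v u i :
  hybrid_chain k (subst_at k y x) v u i =
  hybrid_chain k.+1 (subst_at k (y + th (hybrid_chain k x v u k) * s ^+ 2) x) v u i.
Proof.
have low j : (j <= k)%N -> hybrid_chain k.+1 x v u j = hybrid_chain k x v u j.
  move=> jk; apply: eq_chain => // l y' lj; rewrite /hybrid ltnS.
  by rewrite (leq_trans lj jk) (ltnW (leq_trans lj jk)).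
have [ik|ki] := leqP i k; first by rewrite !hybrid_chain_subst// low.
elim: i ki => // i ih; rewrite ltnS leq_eqVlt => /predU1P[<-{i ih}|ki].
  rewrite /hybrid_chain /= -!/(hybrid_chain _ _ _ _ _) !hybrid_chain_subst// low//.
  rewrite /hybrid ltnn ltnSn /noisy /subst_at eqxx f1E; ring.
rewrite /hybrid_chain /= -!/(hybrid_chain _ _ _ _ _) ih//.
rewrite /hybrid ltnNge ltnW//= ltnS leqNgt ki/=.
by rewrite /noisy /subst_at gtn_eqF.
Qed.

Section measurability.
Context d' (S : measurableType d').
Variables (x v : nat -> S -> R) (u : S -> R).
Hypotheses (mx : forall j, measurable_fun setT (x j))
  (mv : forall j, measurable_fun setT (v j)) (mu : measurable_fun setT u).

Lemma measurable_hybrid_chain k i :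
  measurable_fun setT (fun w => hybrid_chain k (x ^~ w) (v ^~ w) (u w) i).
Proof.
rewrite /hybrid_chain; apply: (@measurable_chain _ _ _ _
  (fun j w => noisy (x ^~ w) (v ^~ w) j)) => // j.
by apply: measurable_funD => //; exact: measurable_funM.
Qed.

Lemma measurable_tilt k :
  measurable_fun setT (fun w => tilt k (x ^~ w) (v ^~ w) (u w)).
Proof.
have mt : measurable_fun setT (fun w => th (hybrid_chain k (x ^~ w) (v ^~ w) (u w) k)).
  by apply: measurableT_comp => //; exact: measurable_hybrid_chain.
apply: measurableT_comp => //; apply: measurable_funB.
  exact: measurable_funM.
by apply: measurable_funM => //; apply: measurable_funM => //; exact: measurable_funX.
Qed.

Lemma measurable_weight k :
  measurable_fun setT (fun w => weight k (x ^~ w) (v ^~ w) (u w)).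
Proof.
by apply: measurable_prod => j _; exact: measurable_tilt.
Qed.

End measurability.

Lemma weight_ge0 k x v u : 0 <= weight k x v u.
Proof. by apply: prodr_ge0 => j _; exact: expR_ge0. Qed.

(** [xi k] is independent of all the rest, so it may be replaced by a variable [y]
integrated against its own law. *)
Lemma integral_resample k (F : (nat -> R) -> (nat -> R) -> R -> R) :
  (k < n)%N ->
  (forall x v u, 0 <= F x v u) ->
  (forall d' (S : measurableType d') (x v : nat -> S -> R) (u : S -> R),
     (forall j, measurable_fun setT (x j)) ->
     (forall j, measurable_fun setT (v j)) -> measurable_fun setT u ->
     measurable_fun setT (fun w => F (x ^~ w) (v ^~ w) (u w))) ->
  (\int[P]_w (F (xi ^~ w) (V ^~ w) (U w))%:E =
   \int[P]_w \int[normal_prob 0 s]_y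
     (F (subst_at k y (xi ^~ w)) (V ^~ w) (U w))%:E)%E.
Proof.
move=> kn F0 mF.
pose g (p : g_sigma_algebraType (G k) * measurableTypeR R) : \bar R :=
  (F (subst_at k p.2 (xi ^~ p.1)) (V ^~ p.1) (U p.1))%:E.
have mg : measurable_fun setT g.
  apply/measurable_EFinP; rewrite /subst_at.
  apply: (mF _ _ (fun j (p : g_sigma_algebraType (G k) * measurableTypeR R) =>
    if j == k then p.2 else xi j p.1) (fun j p => V j p.1) (fun p => U p.1)) => [j|j|].
  - have [_|jk] := eqVneq j k; first exact: measurable_snd.
    exact: measurableT_comp (mxiG jk) measurable_fst.
  - exact: measurableT_comp (@mVG k j) measurable_fst.
  - exact: measurableT_comp (@mUG k) measurable_fst.
transitivity (\int[P]_w g (w, xi k w))%E.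
  by apply: eq_integral => w _; rewrite /g/= subst_at_id.
rewrite (@integral_freezing _ _ _ P _ (measurableTypeR R) (G k) (xi k)
  (normal_prob 0 s) (@Gm k) (@GI k) (GT k) (mxi k)
  (fun A B => @indep k A B kn) g mg)//.
by move=> p; rewrite lee_fin.
Qed.

Lemma tilt_subst k y x v u :
  tilt k (subst_at k y x) v u =
  (let t := th (hybrid_chain k x v u k) in expR (t * y - t ^+ 2 * s ^+ 2 / 2)).
Proof. by rewrite /tilt hybrid_chain_subst// /subst_at eqxx. Qed.

(** With all other variables frozen, exchanging the drift at step [k] shifts a
single Gaussian variable; [normal_shift] turns this into the factor [tilt k]. *)
Lemma integral_hybrid_step (Psi : (nat -> R) -> R) k : (k < n)%N ->
  pathwise_measurable Psi -> (forall e, 0 <= Psi e) ->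
  (\int[P]_w (weight k (xi ^~ w) (V ^~ w) (U w)
              * Psi (hybrid_chain k (xi ^~ w) (V ^~ w) (U w)))%:E =
   \int[P]_w (weight k.+1 (xi ^~ w) (V ^~ w) (U w)
              * Psi (hybrid_chain k.+1 (xi ^~ w) (V ^~ w) (U w)))%:E)%E.
Proof.
move=> kn mPsi Psi0.
pose F m x v u := weight m x v u * Psi (hybrid_chain m x v u).
have F0 m x v u : 0 <= F m x v u by rewrite mulr_ge0// weight_ge0.
have mF m d' (S : measurableType d') (x v : nat -> S -> R) (u : S -> R) :
     (forall j, measurable_fun setT (x j)) ->
     (forall j, measurable_fun setT (v j)) -> measurable_fun setT u ->
     measurable_fun setT (fun w => F m (x ^~ w) (v ^~ w) (u w)).
  move=> mx mv mu; apply: measurable_funM; first exact: measurable_weight.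
  apply: (mPsi _ _ (fun i w => hybrid_chain m (x ^~ w) (v ^~ w) (u w) i)) => i.
  exact: measurable_hybrid_chain.
rewrite (@integral_resample k (F k) kn (F0 k) (mF k)).
rewrite (@integral_resample k (F k.+1) kn (F0 k.+1) (mF k.+1)).
apply: eq_integral => w _.
set x := xi ^~ w; set v := V ^~ w; set u := U w.
pose t := th (hybrid_chain k x v u k).
pose phi y := (weight k x v u * Psi (hybrid_chain k.+1 (subst_at k y x) v u))%:E.
transitivity (\int[normal_prob 0 s]_y phi (y + t * s ^+ 2)%R)%E.
  apply: eq_integral => y _; rewrite /phi /F weight_subst; congr (_ * Psi _)%:E.
  by apply/funext => i; exact: hybrid_chainS_subst.
rewrite normal_shift//.
- apply: eq_integral => y _; rewrite /phi /F -EFinM; congr _%:E.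
  rewrite /weight big_ord_recr/= -!/(weight _ _ _ _) weight_subst tilt_subst.
  by rewrite mulrAC.
- apply/measurable_EFinP; apply: measurable_funM => //.
  apply: (mPsi _ _ (fun i y => hybrid_chain k.+1 (subst_at k y x) v u i)) => i.
  rewrite /subst_at.
  apply: (@measurable_hybrid_chain _ _ (fun j y => if j == k then y else x j)
    (fun j y => v j) (fun=> u)) => // j.
  by case: eqVneq.
- by move=> y; rewrite lee_fin mulr_ge0// weight_ge0.
Qed.

Lemma integral_hybrid (Psi : (nat -> R) -> R) k : (k <= n)%N ->
  pathwise_measurable Psi -> (forall e, 0 <= Psi e) ->
  (\int[P]_w (Psi (hybrid_chain 0 (xi ^~ w) (V ^~ w) (U w)))%:E =
   \int[P]_w (weight k (xi ^~ w) (V ^~ w) (U w)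
              * Psi (hybrid_chain k (xi ^~ w) (V ^~ w) (U w)))%:E)%E.
Proof.
move=> + mPsi Psi0; elim: k => [_|k ih kn].
  by apply: eq_integral => w _; rewrite /weight big_ord0 mul1r.
by rewrite ih 1?ltnW// integral_hybrid_step.
Qed.

(** With the other variables frozen, the square of each factor has expectation
[expR (t ^+ 2 * s ^+ 2)], where [t] is at most [kappa] in absolute value. *)
Lemma integral_sqr_weight k : (k <= n)%N ->
  (\int[P]_w ((weight k (xi ^~ w) (V ^~ w) (U w)) ^+ 2)%:E
   <= (expR (kappa ^+ 2 * s ^+ 2 * k%:R))%:E)%E.
Proof.
elim: k => [_|k ih kn].
  rewrite mulr0 expR0 (eq_integral (cst 1%E)); last first.
    by move=> w _; rewrite /weight big_ord0 expr1n.
  by rewrite integral_cst// mul1e probability_le1.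
pose F m x v u := (weight m x v u) ^+ 2.
have mF m d' (S : measurableType d') (x v : nat -> S -> R) (u : S -> R) :
     (forall j, measurable_fun setT (x j)) ->
     (forall j, measurable_fun setT (v j)) -> measurable_fun setT u ->
     measurable_fun setT (fun w => F m (x ^~ w) (v ^~ w) (u w)).
  by move=> mx mv mu; apply: measurable_funX; exact: measurable_weight.
have mUG0 := measurable_to_g_sigma (@Gm k) (@mUG k).
have mVG0 j := measurable_to_g_sigma (@Gm k) (@mVG k j).
rewrite (@integral_resample k (F k.+1) kn (fun _ _ _ => sqr_ge0 _) (mF k.+1)).
pose t w := th (hybrid_chain k (xi ^~ w) (V ^~ w) (U w) k).
rewrite (eq_integral (fun w => (expR (t w ^+ 2 * s ^+ 2)
    * F k (xi ^~ w) (V ^~ w) (U w))%:E)); last first.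
  move=> w _; set W := F k _ _ _.
  have W0 : 0 <= expR (t w ^+ 2 * s ^+ 2) * W.
    by rewrite mulr_ge0 ?expR_ge0 ?sqr_ge0.
  pose phi (y : R) : \bar R := (expR (t w ^+ 2 * s ^+ 2) * W)%:E.
  transitivity (\int[normal_prob 0 s]_y phi (y + (2 * t w) * s ^+ 2)%R)%E;
    last by rewrite integral_cst// -[RHS]mule1; congr (_ * _)%E; exact: probability_setT.
  rewrite (normal_shift (2 * t w) s0 (measurable_cst _ : measurable_fun setT phi)
    (fun _ => W0 : (0 <= phi _)%E)).
  apply: eq_integral => y _; rewrite /F /weight big_ord_recr/=.
  rewrite -!/(weight _ _ _ _) weight_subst tilt_subst /= -/(t w) -EFinM.
  rewrite /W /F; congr (_%:E).
  rewrite exprMn -expRM_natl [RHS]mulrAC -expRD mulrC.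
  congr (expR _ * _); by field.
apply: (@le_trans _ _ (\int[P]_w ((expR (kappa ^+ 2 * s ^+ 2))%:E
   * (F k (xi ^~ w) (V ^~ w) (U w))%:E))%E).
  apply: ge0_le_integral => //.
  - by move=> w _; rewrite lee_fin mulr_ge0 ?expR_ge0 ?sqr_ge0.
  - apply/measurable_EFinP; apply: measurable_funM; last exact: mF.
    apply: measurableT_comp => //; apply: measurable_funM => //.
    apply: measurable_funX; apply: measurableT_comp => //.
    exact: measurable_hybrid_chain.
  - by apply: emeasurable_funM => //; apply/measurable_EFinP; exact: mF.
  - move=> w _; rewrite -EFinM lee_fin ler_wpM2r ?sqr_ge0// ler_expR.
    rewrite ler_wpM2r ?sqr_ge0// -(@real_normK _ (t w)) ?num_real//.
    have tk : `|t w| <= kappa by exact: th_bnd.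
    by rewrite ler_sqr ?nnegrE ?(le_trans _ tk).
rewrite ge0_integralZl//; last 2 first.
- by apply/measurable_EFinP; exact: mF.
- by move=> w _; rewrite lee_fin sqr_ge0.
rewrite -natr1 mulrDr mulr1 addrC expRD EFinM lee_wpmul2l//.
by apply: ih; exact: ltnW.
Qed.

(** The integral to be bounded is that of [W * p], where [W] is the likelihood ratio
and [p] the value of [Psi]. The inequality [W * p <= W ^+ 2 / (4 * C) + C * p ^+ 2]
plays the role of Cauchy-Schwarz while keeping the estimate affine in [Psi]; when
[C] bounds the second moment of [W], the first term contributes at most 1/4. *)
Lemma change_of_drift (Psi : (nat -> R) -> R) :
  pathwise_measurable Psi -> (forall e, 0 <= Psi e <= 1) ->
  (\int[P]_w (Psi (hybrid_chain 0 (xi ^~ w) (V ^~ w) (U w)))%:E <=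
   (1 / 4)%:E +
   (expR (kappa ^+ 2 * s ^+ 2 * n%:R))%:E
   * \int[P]_w (Psi (hybrid_chain n (xi ^~ w) (V ^~ w) (U w)))%:E)%E.
Proof.
move=> mPsi Psi01; set C := expR _.
have Psi0 e : 0 <= Psi e by case/andP: (Psi01 e).
have C0 : 0 < C by exact: expR_gt0.
have mUG0 := measurable_to_g_sigma (@Gm 0%N) (@mUG 0%N).
have mVG0 j := measurable_to_g_sigma (@Gm 0%N) (@mVG 0%N j).
have mW : measurable_fun setT (fun w => weight n (xi ^~ w) (V ^~ w) (U w)).
  exact: measurable_weight.
have mY : measurable_fun setT (fun w => Psi (hybrid_chain n (xi ^~ w) (V ^~ w) (U w))).
  apply: (mPsi _ _ (fun i w => hybrid_chain n (xi ^~ w) (V ^~ w) (U w) i)) => i.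
  exact: measurable_hybrid_chain.
rewrite (@integral_hybrid _ n)//.
apply: (@le_trans _ _ (\int[P]_w (
   (1 / (4 * C))%:E * ((weight n (xi ^~ w) (V ^~ w) (U w)) ^+ 2)%:E
   + C%:E * (Psi (hybrid_chain n (xi ^~ w) (V ^~ w) (U w)))%:E))%E).
  apply: ge0_le_integral => //.
  - by move=> w _; rewrite lee_fin mulr_ge0// weight_ge0.
  - by apply/measurable_EFinP; exact: measurable_funM.
  - by apply: emeasurable_funD; apply: emeasurable_funM => //;
      apply/measurable_EFinP => //; exact: measurable_funX.
  - move=> w _; rewrite -!EFinM -EFinD lee_fin.
    set W := weight _ _ _ _; set p := Psi _.
    have /andP[p0 p1] : 0 <= p <= 1 by exact: Psi01.
    (* the inequality W p <= W^2 / (4 C) + C p^2 is this square *)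
    have : 0 <= (W - 2 * C * p) ^+ 2 / (4 * C).
      by rewrite divr_ge0 ?sqr_ge0// mulr_ge0// ltW.
    have -> : (W - 2 * C * p) ^+ 2 / (4 * C) = 1 / (4 * C) * W ^+ 2 + C * (p * p) - W * p.
      field; by rewrite gt_eqF.
    have : C * (p * p) <= C * p by rewrite ler_pM2l// ler_piMr.
    lra.
rewrite ge0_integralD//; last 4 first.
- by move=> w _; rewrite -EFinM lee_fin mulr_ge0 ?sqr_ge0// divr_ge0// mulr_ge0// ltW.
- by apply: emeasurable_funM => //; apply/measurable_EFinP; exact: measurable_funX.
- by move=> w _; rewrite -EFinM lee_fin mulr_ge0// ltW.
- by apply: emeasurable_funM => //; exact/measurable_EFinP.
rewrite ge0_integralZl//; last 3 first.
- by apply/measurable_EFinP; exact: measurable_funX.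
- by move=> w _; rewrite lee_fin sqr_ge0.
- by rewrite lee_fin divr_ge0// mulr_ge0// ltW.
rewrite ge0_integralZl//; last 3 first.
- exact/measurable_EFinP.
- by move=> w _; rewrite lee_fin.
- by rewrite lee_fin ltW.
apply: leeD => //.
apply: (@le_trans _ _ ((1 / (4 * C))%:E * C%:E)%E).
  rewrite lee_wpmul2l//; first by rewrite lee_fin divr_ge0// mulr_ge0// ltW.
  exact: integral_sqr_weight.
by rewrite -EFinM (_ : 1 / (4 * C) * C = 1 / 4)//; field; rewrite gt_eqF.
Qed.


End change_of_drift.

(** * Cylinder functionals of the observed path *)

Section bounded_convergence.
Context d (Om : measurableType d) (R : realType) (P : probability Om R).

Lemma bounded_convergence (f_ : nat -> Om -> R) (f : Om -> R) (M : R) :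
  (forall n, measurable_fun setT (f_ n)) -> measurable_fun setT f ->
  {ae P, forall w, (fun n => f_ n w) @ \oo --> f w} ->
  (forall n w, `|f_ n w| <= M) ->
  (\int[P]_w (f_ n w)%:E)%E @[n --> \oo] --> (\int[P]_w (f w)%:E)%E.
Proof.
move=> mf_ mf ff fM.
have [] := @dominated_convergence _ _ _ P setT measurableT
  (fun n w => (f_ n w)%:E) (EFin \o f) (cst M%:E) => //.
- by move=> n; exact/measurable_EFinP.
- exact/measurable_EFinP.
- by apply: filterS ff => w fw _; apply: cvg_EFin => //; exact: nearW.
- exact: finite_measure_integrable_cst.
- by apply: aeW => w n _; rewrite /= lee_fin.
Qed.

Lemma bounded_convergence0 (f_ : nat -> Om -> R) (M e : R) : 0 < e ->
  (forall n, measurable_fun setT (f_ n)) ->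
  (forall w, (fun n => f_ n w) @ \oo --> 0) ->
  (forall n w, 0 <= f_ n w <= M) ->
  exists n, (\int[P]_w (f_ n w)%:E <= e%:E)%E.
Proof.
move=> e0 mf_ ff fM.
have H : (\int[P]_w (f_ n w)%:E)%E @[n --> \oo] -->
    (\int[P]_w (cst (0:R) w)%:E)%E.
  apply: (@bounded_convergence _ _ M) => //; first exact: aeW.
  by move=> n w; have /andP[? ?] := fM n w; rewrite ger0_norm.
have {}H := H _ (@open_ereal_lt' _ _ e%:E _).
have /H[N _ /(_ N (leqnn N)) /ltW] : (\int[P]_w (cst (0:R) w)%:E < e%:E)%E.
  by rewrite /= integral0 lte_fin.
by exists N.
Qed.

End bounded_convergence.

Lemma cvg_maxr (R : realType) I (F : set_system I) (FF : Filter F)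
    (u v : I -> R) (a b : R) :
  u @ F --> a -> v @ F --> b -> (fun i => Num.max (u i) (v i)) @ F --> Num.max a b.
Proof.
move=> ua vb; rewrite maxr_absE.
under eq_fun do rewrite maxr_absE.
apply: cvgM; last exact: cvg_cst.
apply: cvgD; first exact: cvgD.
by apply: cvg_norm; exact: cvgB.
Qed.

Section cylinder.
Context {R : realType}.

(** [k * (x - c)] clamped to [0, 1]; as [k] grows it tends to the indicator of the
ray [x > c]. *)
Definition ramp (k c x : R) : R := 1 - Num.max 0 (1 - Num.max 0 (k * (x - c))).

(** Functionals of finitely many coordinates that are continuous for pointwise
convergence; the closure operations are the functional counterparts of the
complement and of the union of events. *)
Inductive cylinder (T : R) : ((R -> R) -> R) -> Prop :=
| cylinder_ramp t k c : 0 <= t <= T -> cylinder T (fun w => ramp k c (w t))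
| cylinder_compl g : cylinder T g -> cylinder T (fun w => 1 - g w)
| cylinder_max g1 g2 : cylinder T g1 -> cylinder T g2 ->
    cylinder T (fun w => Num.max (g1 w) (g2 w)).

Lemma ramp01 k c x : 0 <= ramp k c x <= 1.
Proof.
rewrite /ramp; set m := Num.max 0 (_ * _); set M := Num.max 0 _.
have : 0 <= m by rewrite le_max lexx.
have : 0 <= M by rewrite le_max lexx.
move=> M0 m0; have : M <= 1 by rewrite /M ge_max ler01/=; lra.
by move=> M1; apply/andP; split; lra.
Qed.

Lemma continuous_ramp k c : continuous (ramp k c).
Proof.
move=> x; apply: cvgB; first exact: cvg_cst.
apply: cvg_maxr; first exact: cvg_cst.
apply: cvgB; first exact: cvg_cst.
apply: cvg_maxr; first exact: cvg_cst.
apply: cvgM; first exact: cvg_cst.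
by apply: cvgB; [exact: cvg_id|exact: cvg_cst].
Qed.

Variable T : R.

Lemma cylinder01 g w : cylinder T g -> 0 <= g w <= 1.
Proof.
elim => {g} [t k c _|g _ /andP[g0 g1]|g1 g2 _ /andP[? ?] _ /andP[? ?]].
- exact: ramp01.
- by apply/andP; split; lra.
- by rewrite le_max ge_max; apply/andP; split; [apply/orP; left|apply/andP; split].
Qed.

Lemma eq_cylinder (w w' : R -> R) g : cylinder T g ->
  (forall t, 0 <= t <= T -> w t = w' t) -> g w = g w'.
Proof.
move=> + ww'; elim => {g} [t k c tT|g _ ih|g1 g2 _ ih1 _ ih2].
- by rewrite ww'.
- by rewrite ih.
- by rewrite ih1 ih2.
Qed.

Lemma measurable_cylinder d (S : measurableType d) (e : R -> S -> R) g :
  cylinder T g -> (forall t, 0 <= t <= T -> measurable_fun setT (e t)) ->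
  measurable_fun setT (fun w => g (e ^~ w)).
Proof.
move=> + me; elim => {g} [t k c tT|g _ ih|g1 g2 _ ih1 _ ih2].
- apply: measurableT_comp (me _ tT).
  by apply: continuous_measurable_fun; exact: continuous_ramp.
- exact: measurable_funB.
- exact: measurable_maxr.
Qed.

Lemma cvg_cylinder (e_ : nat -> R -> R) (e : R -> R) g : cylinder T g ->
  (forall t, 0 <= t <= T -> (fun n => e_ n t) @ \oo --> e t) ->
  (fun n => g (e_ n)) @ \oo --> g e.
Proof.
move=> + ee; elim => {g} [t k c tT|g _ ih|g1 g2 _ ih1 _ ih2].
- by apply: (continuous_cvg _ _ (ee _ tT)); exact: continuous_ramp.
- by apply: cvgB => //; exact: cvg_cst.
- exact: cvg_maxr.
Qed.

End cylinder.

Section approximation.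
Context d (Om : measurableType d) (R : realType) (P : probability Om R).
Variables (T : R) (X1 X2 : Om -> observed_path T).
Hypotheses (T0 : 0 <= T) (mX1 : measurable_fun setT X1) (mX2 : measurable_fun setT X2).

Let path (x : observed_path T) (t : R) : R := path_at t x.

Lemma measurable_coordinate (t : R) : 0 <= t <= T ->
  measurable_fun setT (fun x : observed_path T => path x t).
Proof.
move=> tT _ B mB; do 2 apply: sub_sigma_algebra.
by exists t => //; exists B.
Qed.

Let dist (f g : observed_path T -> R) (w : Om) : R :=
  `|f (X1 w) - g (X1 w)| + `|f (X2 w) - g (X2 w)|.

Let measurable_dist f g :
  measurable_fun setT f -> measurable_fun setT g ->
  measurable_fun setT (dist f g).
Proof.
move=> mf mg.
by apply: measurable_funD; apply: measurableT_comp => //; apply: measurable_funB;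
   apply: measurableT_comp.
Qed.

Let dist_ge0 f g w : 0 <= dist f g w.
Proof. by rewrite addr_ge0. Qed.

Let dist_triangle f g h : measurable_fun setT f -> measurable_fun setT g ->
  measurable_fun setT h ->
  (\int[P]_w (dist f h w)%:E <=
   \int[P]_w (dist f g w)%:E + \int[P]_w (dist g h w)%:E)%E.
Proof.
move=> mf mg mh; rewrite -ge0_integralD//; last 4 first.
- by move=> w _; rewrite lee_fin.
- by apply/measurable_EFinP; exact: measurable_dist.
- by move=> w _; rewrite lee_fin.
- by apply/measurable_EFinP; exact: measurable_dist.
apply: ge0_le_integral => //.
- by move=> w _; rewrite lee_fin.
- by apply/measurable_EFinP; exact: measurable_dist.
- by apply/measurable_EFinP/measurable_funD; exact: measurable_dist.
move=> w _; rewrite -EFinD lee_fin /dist.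
have := ler_distD (g (X1 w)) (f (X1 w)) (h (X1 w)).
have := ler_distD (g (X2 w)) (f (X2 w)) (h (X2 w)).
lra.
Qed.

(** The approximation is in L1 under the laws of [X1] and of [X2] at once, so that
a single cylinder functional serves both sides of an inequality. *)
Definition approximable (f : observed_path T -> R) : Prop :=
  [/\ measurable_fun setT f, forall x, 0 <= f x <= 1 &
      forall e, 0 < e -> exists2 g, cylinder T g &
        (\int[P]_w (dist f (g \o path) w)%:E <= e%:E)%E].

Let measurable_cyl g : cylinder T g -> measurable_fun setT (g \o path).
Proof.
move=> cg; apply: (@measurable_cylinder _ T _ _ (fun t x => path x t)) => //.
exact: measurable_coordinate.
Qed.

Lemma approximable_cylinder g : cylinder T g -> approximable (g \o path).
Proof.
move=> cg; split => [|x|e e0]; first exact: measurable_cyl.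
  exact: cylinder01 cg.
exists g => //; rewrite (eq_integral (cst 0%E)); last first.
  by move=> w _; rewrite /dist !subrr normr0 addr0.
by rewrite integral0 lee_fin ltW.
Qed.

Lemma approximable_lim (f_ : nat -> observed_path T -> R) f :
  (forall n, approximable (f_ n)) ->
  (forall x, (fun n => f_ n x) @ \oo --> f x) -> approximable f.
Proof.
move=> af ff.
have mf_ n : measurable_fun setT (f_ n) by by case: (af n).
have mf : measurable_fun setT f.
  by apply: (@measurable_fun_cvg _ _ _ _ f_) => // x _; exact: ff.
have f_01 n x : 0 <= f_ n x <= 1 by have [_ + _] := af n; apply.
have f01 x : 0 <= f x <= 1.
  apply/andP; split.
    by apply: (cvgr_to_ge (ff x)); apply: nearW => n; case/andP: (f_01 n x).
  by apply: (cvgr_to_le (ff x)); apply: nearW => n; case/andP: (f_01 n x).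
split => // e e0.
have e20 : 0 < e / 2 by rewrite divr_gt0.
have [n dn] : exists n, (\int[P]_w (dist f (f_ n) w)%:E <= (e / 2)%:E)%E.
  apply: (@bounded_convergence0 _ _ _ P (fun n w => dist f (f_ n) w) 2) => //.
  - by move=> n; exact: measurable_dist.
  - move=> w; rewrite [X in _ --> X](_ : 0 =
      `|f (X1 w) - f (X1 w)| + `|f (X2 w) - f (X2 w)|); last first.
      by rewrite !subrr normr0 addr0.
    by apply: cvgD; apply: cvg_norm; apply: cvgB => //; exact: cvg_cst.
  - move=> n w; rewrite dist_ge0/= /dist.
    have /andP[? ?] := f_01 n (X1 w); have /andP[? ?] := f_01 n (X2 w).
    have /andP[? ?] := f01 (X1 w); have /andP[? ?] := f01 (X2 w).
    have : `|f (X1 w) - f_ n (X1 w)| <= 1 by rewrite ler_norml; apply/andP; split; lra.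
    have : `|f (X2 w) - f_ n (X2 w)| <= 1 by rewrite ler_norml; apply/andP; split; lra.
    lra.
have [_ _ /(_ _ e20)[g cg dg]] := af n.
exists g => //.
apply: (le_trans (dist_triangle mf (mf_ n) (measurable_cyl cg))).
by rewrite (le_trans (leeD dn dg))// -EFinD lee_fin -splitr.
Qed.

Lemma approximable_compl f : approximable f -> approximable (fun x => 1 - f x).
Proof.
move=> [mf f01 af]; split.
- exact: measurable_funB.
- by move=> x; have /andP[? ?] := f01 x; apply/andP; split; lra.
- move=> e /af[g cg dg]; exists (fun w => 1 - g w); first exact: cylinder_compl.
  apply: le_trans dg; rewrite le_eqVlt; apply/orP; left; apply/eqP.
  apply: eq_integral => w _; congr (_ + _)%:E; rewrite /= -normrN; congr `|_|; ring.
Qed.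

Lemma approximable_max f g : approximable f -> approximable g ->
  approximable (fun x => Num.max (f x) (g x)).
Proof.
move=> [mf f01 af] [mg g01 ag].
split.
- exact: measurable_maxr.
- move=> x; have /andP[? ?] := f01 x; have /andP[? ?] := g01 x.
  by rewrite le_max ge_max; apply/andP; split; [apply/orP; left|apply/andP; split].
- move=> e e0; have e20 : 0 < e / 2 by rewrite divr_gt0.
  have [f' cf df] := af _ e20; have [g' cg dg] := ag _ e20.
  exists (fun w => Num.max (f' w) (g' w)); first exact: cylinder_max.
  apply: (@le_trans _ _ ((e / 2)%:E + (e / 2)%:E)%E); last first.
    by rewrite -EFinD lee_fin -splitr.
  apply: le_trans (leeD df dg); rewrite -ge0_integralD//; last 4 first.
  + by move=> w _; rewrite lee_fin.
  + by apply/measurable_EFinP; apply: measurable_dist => //; exact: measurable_cyl.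
  + by move=> w _; rewrite lee_fin.
  + by apply/measurable_EFinP; apply: measurable_dist => //; exact: measurable_cyl.
  have max_dist (a b a' b' : R) :
      `|Num.max a b - Num.max a' b'| <= `|a - a'| + `|b - b'|.
    have := ler_norm (a - a'); have := ler_norm (b - b').
    have := ler_norm (a' - a); have := ler_norm (b' - b).
    rewrite (distrC a') (distrC b') ler_norml.
    by case: (leP a b) => ?; case: (leP a' b') => ? *; apply/andP; split; lra.
  apply: ge0_le_integral => //.
  + by move=> w _; rewrite lee_fin.
  + apply/measurable_EFinP; apply: measurable_dist.
      exact: measurable_maxr.
    by apply: (@measurable_maxr _ _ _ _ (f' \o path) (g' \o path)); exact: measurable_cyl.
  + apply/measurable_EFinP/measurable_funD; apply: measurable_dist => //;
      exact: measurable_cyl.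
  + move=> w _; rewrite -EFinD lee_fin /dist /=.
    have := max_dist (f (X1 w)) (g (X1 w)) (f' (path (X1 w))) (g' (path (X1 w))).
    have := max_dist (f (X2 w)) (g (X2 w)) (f' (path (X2 w))) (g' (path (X2 w))).
    lra.
Qed.

(** The events with an approximable indicator form a sigma-algebra, and it contains
the events [path x t > c] as limits of ramps. *)
Lemma approximable_measurable (A : set (observed_path T)) :
  measurable A -> approximable \1_A.
Proof.
pose D := [set A : set (observed_path T) | approximable \1_A].
have D0 : D set0.
  rewrite /D/= (_ : \1_set0 = (fun w => ramp 0 0 (w 0)) \o path).
    by apply: approximable_cylinder; apply: cylinder_ramp; rewrite lexx.
  by apply/funext => x; rewrite indic0 /= /ramp mul0r maxxx subr0 max_r// subrr.
have DC A' : D A' -> D (setT `\` A').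
  move=> DA; rewrite /D/= (_ : \1_(setT `\` A') = fun x => 1 - \1_A' x).
    exact: approximable_compl.
  apply/funext => x; rewrite setTD !indicE in_setC.
  by case: (x \in A'); rewrite /= ?subrr ?subr0.
have DU A1 A2 : D A1 -> D A2 -> D (A1 `|` A2).
  move=> DA1 DA2; rewrite /D/= (_ : \1_(A1 `|` A2) =
      fun x => Num.max (\1_A1 x) (\1_A2 x)).
    exact: approximable_max.
  apply/funext => x; rewrite !indicE in_setU.
  by case: (x \in A1); case: (x \in A2);
    rewrite /= ?maxxx// ?(max_l ler01) ?(max_r ler01).
have Dbigcup (F : nat -> set (observed_path T)) :
    (forall n, D (F n)) -> D (\bigcup_k F k).
  move=> DF.
  have DFn n : D (\big[setU/set0]_(k < n) F k).
    by elim: n => [|n ih]; rewrite ?big_ord0// big_ord_recr/=; exact: DU.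
  apply: (approximable_lim (f_ := fun n => \1_(\big[setU/set0]_(k < n) F k))) => // x.
  have [[k _ Fkx]|nFx] := pselect ((\bigcup_k F k) x).
  - rewrite indicE mem_set; last by exists k.
    apply: cvg_near_cst; exists k.+1 => // n /= kn.
    rewrite indicE mem_set// -bigcup_mkord; exists k => //=.
  - rewrite indicE memNset//.
    apply: cvg_near_cst; apply: nearW => n.
    rewrite indicE memNset// -bigcup_mkord => -[k _ Fkx]; apply: nFx; exists k => //.
have sD : sigma_algebra setT D by split.
suff gD t B : 0 <= t <= T -> measurable B -> D ((fun x => path x t) @^-1` B).
  have S1 : sigma_family [set t | 0 <= t <= T] (@path_at R) `<=` D.
    apply: (smallest_sub sD) => _ [t tT [B mB <-]].
    by rewrite setTI; exact: gD.
  by move=> mA; exact: (smallest_sub sD S1 mA).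
move=> tT; have sI := @sigma_algebra_image _ _ _ (fun x => path x t) _ sD.
have DI C : image_set_system setT (fun x => path x t) D C ->
    D ((fun x => path x t) @^-1` C) by rewrite /image_set_system/= setTI.
have -> : (measurable : set (set R)) = <<s @RGenOInfty.G R >>.
  exact: RGenOInfty.measurableE.
move=> GB; apply: DI; move: B GB; apply: (smallest_sub sI) => _ [c ->].
rewrite /image_set_system/= setTI.
apply: (approximable_lim (f_ := fun n => (fun w => ramp n%:R c (w t)) \o path)).
  by move=> n; apply: approximable_cylinder; exact: cylinder_ramp.
move=> x; rewrite indicE; have [xc|xc] := leP (path x t) c.
  rewrite memNset; last by rewrite /= in_itv/= andbT ltNge xc.
  apply: cvg_near_cst; apply: nearW => n /=.
  rewrite /ramp [Num.max 0 (n%:R * _)]max_l ?subr0 ?(max_r ler01) ?subrr//.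
  by rewrite mulr_ge0_le0 ?ler0n// subr_le0.
rewrite mem_set; last by rewrite /= in_itv/= andbT.
have xc0 : 0 < path x t - c by rewrite subr_gt0.
apply: cvg_near_cst; exists (Num.truncn (path x t - c)^-1).+1 => // n /= kn.
have xn : 1 <= n%:R * (path x t - c).
  rewrite -ler_pdivrMr// mul1r.
  have := truncnS_gt (path x t - c)^-1.
  by move=> /ltW /le_trans; apply; rewrite ler_nat.
by rewrite /ramp [Num.max 0 (n%:R * _)]max_r ?(le_trans ler01)// max_l ?subr0// subr_le0.
Qed.

(** An inequality that is affine in the functional survives an approximation in L1,
hence extends from cylinder functionals to events. *)
Lemma cylinder_transfer (c0 C : R) : 0 <= C ->
  (forall g, cylinder T g ->
    (\int[P]_w (g (path (X2 w)))%:E <= c0%:E + C%:E * \int[P]_w (g (path (X1 w)))%:E)%E) ->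
  forall A : set (observed_path T), measurable A ->
    (P (X2 @^-1` A) <= c0%:E + C%:E * P (X1 @^-1` A))%E.
Proof.
move=> C0 H A mA.
have [m1 _ aA] := approximable_measurable mA.
have intA (Y : Om -> observed_path T) : measurable_fun setT Y ->
    (\int[P]_w (\1_A (Y w))%:E = P (Y @^-1` A))%E.
  move=> mY; have mYA : measurable (Y @^-1` A).
    by rewrite -[X in measurable X]setTI; exact: mY.
  by rewrite -[in RHS](setIT (Y @^-1` A)) -integral_indic.
apply/lee_addgt0Pr => e e0.
have e'0 : 0 < e / (1 + C) by rewrite divr_gt0// ltr_wpDr.
have [g cg dg] := aA _ e'0.
have mg := measurable_cyl cg.
have le1 (f h : observed_path T -> R) (Y : Om -> observed_path T) :
    Y = X1 \/ Y = X2 -> (forall x, 0 <= f x) -> (forall x, 0 <= h x) ->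
    measurable_fun setT f -> measurable_fun setT h ->
    (\int[P]_w (f (Y w))%:E <= \int[P]_w (h (Y w))%:E + \int[P]_w (dist f h w)%:E)%E.
  move=> YX f0 h0 mf mh.
  have mY : measurable_fun setT Y by case: YX => ->.
  rewrite -ge0_integralD//; last 4 first.
  - by move=> w _; rewrite lee_fin.
  - by apply/measurable_EFinP; exact: measurableT_comp mh mY.
  - by move=> w _; rewrite lee_fin.
  - by apply/measurable_EFinP; exact: measurable_dist.
  apply: ge0_le_integral => //.
  - by move=> w _; rewrite lee_fin.
  - by apply/measurable_EFinP; exact: measurableT_comp mf mY.
  - apply/measurable_EFinP/measurable_funD; first exact: measurableT_comp mh mY.
    exact: measurable_dist.
  move=> w _; rewrite -EFinD lee_fin /dist.
  have := ler_norm (f (X1 w) - h (X1 w)); have := ler_norm (f (X2 w) - h (X2 w)).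
  have := normr_ge0 (f (X1 w) - h (X1 w)); have := normr_ge0 (f (X2 w) - h (X2 w)).
  by case: YX => ->; lra.
have g01 x : 0 <= (g \o path) x by case/andP: (cylinder01 (path x) cg).
have i01 x : 0 <= (\1_A : _ -> R) x by [].
have := le1 \1_A (g \o path) X2 (or_intror erefl) i01 g01 m1 mg.
rewrite intA// => h2.
have := le1 (g \o path) \1_A X1 (or_introl erefl) g01 i01 mg m1.
rewrite intA// => h1.
have dsym : (\int[P]_w (dist (g \o path) \1_A w)%:E =
    \int[P]_w (dist \1_A (g \o path) w)%:E)%E.
  by apply: eq_integral => w _; congr (_ + _)%:E; rewrite distrC.
rewrite dsym in h1.
apply: (le_trans h2); apply: (le_trans (leeD (H _ cg) dg)).
apply: (@le_trans _ _ (c0%:E +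
    C%:E * (P (X1 @^-1` A) + (e / (1 + C))%:E) + (e / (1 + C))%:E)%E).
  rewrite leeD2r// leeD2l// lee_wpmul2l ?lee_fin//.
  by apply: (le_trans h1); rewrite leeD2l.
have PA : P (X1 @^-1` A) \is a fin_num.
  by rewrite fin_num_measure// -[X in measurable X]setTI; exact: mX1.
rewrite -(fineK PA) -EFinD -!EFinM -!EFinD lee_fin.
rewrite le_eqVlt; apply/orP; left; apply/eqP; field.
by rewrite gt_eqF// ltr_wpDr.
Qed.

End approximation.

(** * Convergence of the Euler scheme *)

Section euler_scheme.
Context {R : realType}.
Local Notation leb := (@lebesgue_measure R).
Variables (T K M : R) (b x N : R -> R).
Hypotheses (T0 : 0 < T) (K0 : 0 <= K) (M0 : 0 <= M).

Definition mesh (n : nat) : R := T / n.+1%:R.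
Definition grid (n i : nat) : R := i%:R * mesh n.
(** Times are rounded up, so that right-continuity alone makes the values at grid
points converge. *)
Definition grid_index (n : nat) (t : R) : nat := `|Num.ceil (t / mesh n)|%N.

Lemma mesh_gt0 n : 0 < mesh n.
Proof. by rewrite divr_gt0. Qed.

Lemma gridS n i : grid n i.+1 = grid n i + mesh n.
Proof. by rewrite /grid -natr1 mulrDl mul1r. Qed.

Lemma grid_ge0 n i : 0 <= grid n i.
Proof. by rewrite mulr_ge0// ltW// mesh_gt0. Qed.

Lemma grid_max n : grid n n.+1 = T.
Proof. by rewrite /grid /mesh mulrC divfK. Qed.

Lemma grid_le n i j : (i <= j)%N -> grid n i <= grid n j.
Proof. by move=> ij; rewrite ler_pM2r ?mesh_gt0// ler_nat. Qed.

Lemma grid_index_eq n k t : 0 <= t ->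
  (grid_index n t == k) = (grid n k - mesh n < t <= grid n k).
Proof.
move=> t0; have d0 := mesh_gt0 n.
have c0 : 0 <= Num.ceil (t / mesh n).
  by rewrite ceil_ge0 (lt_le_trans (ltrN10 R))// divr_ge0// ltW.
transitivity (Num.ceil (t / mesh n) == k%:Z).
  by rewrite /grid_index -(eqr_nat int) !natz gez0_abs.
rewrite ceil_eq intrD !mulrNz ltr_pdivlMr// ler_pdivrMr//.
by rewrite /grid mulrBl mul1r.
Qed.

Lemma grid_indexP n t : 0 <= t ->
  grid n (grid_index n t) - mesh n < t <= grid n (grid_index n t).
Proof. by move=> t0; rewrite -grid_index_eq. Qed.

Lemma grid_index_le n t : 0 <= t <= T -> (grid_index n t <= n.+1)%N.
Proof.
move=> /andP[t0 tT]; have /andP[+ _] := grid_indexP n t0.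
rewrite leqNgt; apply: contraTN => nk; rewrite -leNgt (le_trans tT)//.
by rewrite -(grid_max n) lerBrDr -gridS grid_le.
Qed.

Lemma cvg_mesh : mesh @ \oo --> 0.
Proof.
rewrite -(mulr0 T); apply: cvgM; first exact: cvg_cst.
exact: (@cvg_harmonic R).
Qed.

Hypotheses (Kb : forall u v, `|b u - b v| <= K * `|u - v|)
  (Mb : forall u, `|b u| <= M)
  (rcx : forall t, 0 <= t -> x @ t^'+ --> x t).

Lemma cvg_path_grid t : 0 <= t ->
  (fun n => x (grid n (grid_index n t))) @ \oo --> x t.
Proof.
move=> t0; apply/cvgrPdist_lt => e e0.
have /cvgrPdist_lt /(_ _ e0) := rcx t0.
rewrite near_withinE => -[r /= r0 Hr].
have : \forall n \near \oo, mesh n < r.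
  by have := cvg_mesh; move/cvgr_lt; apply.
apply: filterS => n nr; have /andP[t1 t2] := grid_indexP n t0.
move: t2; rewrite le_eqVlt => /predU1P[<-|t2]; first by rewrite subrr normr0.
apply: Hr => //=; rewrite distrC gtr0_norm ?subr_gt0//.
lra.
Qed.

Let D (t : R) : set R := `[0, t]%classic.

Lemma measurable_path_grid n (c : R -> R) t :
  measurable_fun (D t) (fun s => c (grid n (grid_index n s))).
Proof.
move=> mD B mB.
rewrite (_ : _ `&` _ = \bigcup_(k in [set k | B (c (grid n k))])
    (D t `&` `](grid n k - mesh n), grid n k]%classic)); last first.
  apply/seteqP; split => s /=.
  - move=> [Ds Bs]; exists (grid_index n s) => //; split => //.
    by rewrite /= in_itv/= grid_indexP//; move: Ds; rewrite /D/= in_itv/= => /andP[].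
  - move=> [k Bk [Ds]]; rewrite /= in_itv/=.
    have s0 : 0 <= s by move: Ds; rewrite /D/= in_itv/= => /andP[].
    by rewrite -grid_index_eq// => /eqP ->.
apply: bigcup_measurable => k _; apply: measurableI => //.
Qed.

(** A right-continuous function is the limit of the step functions obtained by
rounding the time up. *)
Lemma measurable_cadlag t : measurable_fun (D t) x.
Proof.
apply: (@measurable_fun_cvg _ _ _ _ (fun n s => x (grid n (grid_index n s)))).
  by move=> n; exact: measurable_path_grid.
move=> s; rewrite /D/= in_itv/= => /andP[s0 _]; exact: cvg_path_grid.
Qed.

Lemma continuous_drift : continuous b.
Proof.
move=> u; apply/cvgrPdist_lt => e e0.
have K1 : 0 < K + 1 by rewrite ltr_wpDl.
exists (e / (K + 1)); first by rewrite /= divr_gt0.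
move=> v /= uv; apply: (le_lt_trans (Kb _ _)).
rewrite (@le_lt_trans _ _ ((K + 1) * `|u - v|))//.
  by rewrite ler_wpM2r//; lra.
by rewrite mulrC -ltr_pdivlMr.
Qed.

Let mbx t : measurable_fun (D t) (b \o x).
Proof.
apply: measurableT_comp; last exact: measurable_cadlag.
by apply: continuous_measurable_fun; exact: continuous_drift.
Qed.

Let finD t : (leb (D t) < +oo)%E.
Proof. by rewrite /D lebesgue_measure_itv; case: ifP; rewrite -?EFinB ltry. Qed.

Let integrable_D (f : R -> R) (c t : R) : measurable_fun (D t) f ->
  (forall s, `|f s| <= c) -> leb.-integrable (D t) (EFin \o f).
Proof.
move=> mf fc; apply: measurable_bounded_integrable => //; [exact: measurable_itv|exact: finD|].
exists c; split; rewrite ?num_real// => y cy s _ /=.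
exact: (le_trans (fc _) (ltW cy)).
Qed.

Let ibx t : leb.-integrable (D t) (EFin \o (b \o x)).
Proof. by apply: (@integrable_D _ M) => // s; exact: Mb. Qed.

Let drift_gap n s := `|b (x (grid n (grid_index n s))) - b (x s)|.

Let drift_gap_le n s : drift_gap n s <= M + M.
Proof. by rewrite /drift_gap (le_trans (ler_normB _ _))// lerD. Qed.

Let mgap n t : measurable_fun (D t) (drift_gap n).
Proof.
apply: measurableT_comp => //; apply: measurable_funB; last exact: mbx.
exact: (measurable_path_grid n (fun s => b (x s))).
Qed.

Let igap n t : leb.-integrable (D t) (EFin \o drift_gap n).
Proof.
apply: (@integrable_D _ (M + M)) => // s.
by rewrite /drift_gap normr_id; exact: drift_gap_le.
Qed.

Let I t := \int[leb]_(s in D t) b (x s).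
Let G n t := \int[leb]_(s in D t) drift_gap n s.

Lemma cvg_gap : (fun n => G n T) @ \oo --> 0.
Proof.
have [] := @dominated_convergence _ _ _ leb (D T) (measurable_itv _)
  (fun n s => (drift_gap n s)%:E) (fun=> 0%E) (cst (M + M)%:E).
- by move=> n; apply/measurable_EFinP; exact: mgap.
- exact: measurable_cst.
- apply: aeW => s Ds; apply: cvg_EFin; first exact: nearW.
  have s0 : 0 <= s by move: Ds; rewrite /D/= in_itv/= => /andP[].
  rewrite [X in _ --> X](_ : 0 = `|b (x s) - b (x s)|); last by rewrite subrr normr0.
  apply: cvg_norm; apply: cvgB; last exact: cvg_cst.
  apply: (@continuous_cvg _ _ _ _ _ (fun n => x (grid n (grid_index n s))) b).
    exact: continuous_drift.
  exact: cvg_path_grid.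
- apply: (@integrable_D (fun=> M + M) (M + M)) => // s.
  by rewrite ger0_norm// addr_ge0.
- apply: aeW => s n Ds; rewrite /= lee_fin /drift_gap normr_id.
  exact: drift_gap_le.
move=> _ _; rewrite integral0 => /fine_cvg.
exact.
Qed.

Hypothesis eqn : forall t, 0 <= t -> x t = x 0 + I t + N t.

Let euler n i := chain (fun _ y => mesh n * b y)
  (fun j => N (grid n j.+1) - N (grid n j)) (x 0) i.

Let incr (f : R -> R) (s t : R) : 0 <= s -> s <= t ->
  leb.-integrable (D t) (EFin \o f) ->
  \int[leb]_(u in D t) f u - \int[leb]_(u in D s) f u =
  \int[leb]_(u in `]s, t]) f u.
Proof.
by move=> s0 st fi; apply: (Rintegral_itvB fi); rewrite bnd_simp.
Qed.

Let sub_D s t : 0 <= s -> `]s, t]%classic `<=` D t.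
Proof.
move=> s0 u; rewrite /D /= !in_itv/= => /andP[su ->].
by rewrite (le_trans s0)// ltW.
Qed.

Let Rintegral_itv (c s t : R) : 0 <= s -> s <= t ->
  \int[leb]_(u in `]s, t]) (cst c u) = c * (t - s).
Proof.
move=> s0 st; rewrite Rintegral_cst//= lebesgue_measure_itv/= lte_fin.
case: ltP => [//|ts]; have -> : t = s by apply/eqP; rewrite eq_le st ts.
by rewrite subrr.
Qed.

Let drift_incr s t : 0 <= s -> s <= t -> `|I t - I s| <= M * (t - s).
Proof.
move=> s0 st; rewrite /I (incr s0 st (ibx t)).
have mst : measurable (`]s, t]%classic : set (measurableTypeR R)) by exact: measurable_itv.
have st_sub : `]s, t]%classic `<=` D t by exact: sub_D.
apply: le_trans (le_normr_Rintegral mst _) _.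
  by apply: integrableS (ibx t) => //; exact: measurable_itv.
rewrite -(Rintegral_itv M s0 st).
apply: le_Rintegral => //; last by move=> u _; exact: Mb.
- apply: integrable_norm; apply: integrableS (ibx t) => //; exact: measurable_itv.
- apply: integrableS (@integrable_D (cst M) M t _ _) => //.
    exact: measurable_itv.
  by move=> u; rewrite ger0_norm.
Qed.

Let gap_incr n i :
  `|mesh n * b (x (grid n i.+1)) - (I (grid n i.+1) - I (grid n i))|
  <= G n (grid n i.+1) - G n (grid n i).
Proof.
have s0 := grid_ge0 n i; have st : grid n i <= grid n i.+1 by exact: grid_le.
rewrite /I /G (incr s0 st (ibx _)) (incr s0 st (igap n _)).
set s := grid n i in s0 st *; set t := grid n i.+1 in st *.
have mst : measurable (`]s, t]%classic : set (measurableTypeR R)) by exact: measurable_itv.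
have st_sub : `]s, t]%classic `<=` D t by exact: sub_D.
have -> : mesh n = t - s by rewrite /t /s gridS addrAC subrr add0r.
have ict c : leb.-integrable `]s, t] (EFin \o cst c).
  apply: integrableS (@integrable_D (cst c) `|c| t _ _) => //; exact: measurable_itv.
have ib : leb.-integrable `]s, t] (EFin \o (b \o x)).
  by apply: integrableS (ibx t) => //; exact: measurable_itv.
rewrite mulrC -(Rintegral_itv (b (x t)) s0 st) -RintegralB//.
apply: le_trans (le_normr_Rintegral mst _) _.
  rewrite (_ : _ \o _ = (EFin \o cst (b (x t))) \- (EFin \o (b \o x)))%E.
    exact: integrableB.
  by apply/funext => u /=; rewrite EFinB.
rewrite le_eqVlt; apply/orP; left; apply/eqP; apply: eq_Rintegral => u.
rewrite inE /= in_itv/= => /andP[su ut]; rewrite /drift_gap.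
suff -> : grid n (grid_index n u) = t by [].
congr grid; apply/eqP; rewrite grid_index_eq ?(le_trans s0 (ltW su))//.
by rewrite ut andbT gridS addrK.
Qed.

Let G_ge0 n t : 0 <= G n t.
Proof. by apply: Rintegral_ge0 => s _; exact: normr_ge0. Qed.

Let G_mono n i j : (i <= j)%N -> G n (grid n i) <= G n (grid n j).
Proof.
move=> ij; elim: j ij => [|j ih]; first by rewrite leqn0 => /eqP ->.
rewrite leq_eqVlt => /predU1P[->//|]; rewrite ltnS => /ih /le_trans; apply.
by rewrite -subr_ge0 (le_trans _ (gap_incr n j)).
Qed.

(** The drift integral of this path lags one mesh behind. Its increment from index
[i] to [i.+1] runs over the interval ending at [grid n i.+1], on which the
rounded-up path equals [x (grid n i.+1)]: this is the point at which the scheme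
evaluates the drift in that very step. A comparison with [x] itself would ask
for rounding down, hence for left limits. *)
Let delayed n i := x 0 + N (grid n i.+1) + I (grid n i).

Let delayed_gap n i : `|delayed n i - x (grid n i.+1)| <= M * mesh n.
Proof.
rewrite eqn ?grid_ge0// /delayed.
rewrite (_ : _ - _ = - (I (grid n i.+1) - I (grid n i))); last ring.
rewrite normrN (le_trans (drift_incr (grid_ge0 _ _) (grid_le n (leqnSn i))))//.
by rewrite gridS addrAC subrr add0r.
Qed.

Let I0 : I 0 = 0.
Proof. by rewrite /I /D set_itv1 Rintegral_set1. Qed.

Let N0 : N 0 = 0.
Proof. by have := eqn (lexx 0); rewrite I0; lra. Qed.

Let grid0 n : grid n 0 = 0.
Proof. by rewrite /grid mul0r. Qed.

(** Discrete Gronwall estimate; the local errors telescope into [G]. *)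
Let euler_error n i :
  `|euler n i.+1 - delayed n i| <=
  (1 + K * mesh n) ^+ i *
  (M * mesh n + i%:R * (K * M * mesh n ^+ 2) + G n (grid n i)).
Proof.
have d0 := ltW (mesh_gt0 n); set q := 1 + K * mesh n.
have q1 : 1 <= q by rewrite lerDl mulr_ge0.
elim: i => [|i ih].
  rewrite expr0 mul1r mul0r addr0 /euler /= /delayed !grid0 I0 N0.
  rewrite (_ : _ - _ = mesh n * b (x 0)); last ring.
  by rewrite normrM ger0_norm// mulrC (le_trans (ler_wpM2r d0 (Mb _)))// lerDl.
set e := euler n i.+1 in ih *; set W := delayed n i in ih *.
set t := grid n i.+1.
have -> : euler n i.+2 - delayed n i.+1 =
    (e - W) + mesh n * (b e - b (x t))
    + (mesh n * b (x t) - (I (grid n i.+1) - I (grid n i))).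
  have -> : euler n i.+2 = e + mesh n * b e + (N (grid n i.+2) - N (grid n i.+1)).
    by [].
  by rewrite /W /delayed /t; ring.
have h1 : `|mesh n * (b e - b (x t))| <= K * mesh n * (`|e - W| + M * mesh n).
  rewrite normrM (ger0_norm d0) (mulrC K) -(mulrA (mesh n) K) ler_wpM2l//.
  rewrite (le_trans (Kb _ _))// ler_wpM2l//.
  by rewrite (le_trans (ler_distD W _ _))// lerD2l; exact: delayed_gap.
have h2 := gap_incr n i.
set g := G n (grid n i.+1) - G n (grid n i) in h2.
have g0 : 0 <= g by rewrite (le_trans _ h2).
apply: (@le_trans _ _ (q * `|e - W| + K * M * mesh n ^+ 2 + g)).
  apply: le_trans (ler_normD _ _) _; apply: lerD => //.
  apply: le_trans (ler_normD _ _) _.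
  apply: (le_trans (lerD (lexx _) h1)); rewrite le_eqVlt; apply/orP; left.
  by apply/eqP; rewrite /q; ring.
have qi : 1 <= q ^+ i.+1 by rewrite exprn_ege1.
have kd : 0 <= K * M * mesh n ^+ 2 by rewrite mulr_ge0 ?sqr_ge0// mulr_ge0.
apply: (@le_trans _ _ (q * (q ^+ i * (M * mesh n + i%:R * (K * M * mesh n ^+ 2)
    + G n (grid n i))) + q ^+ i.+1 * (K * M * mesh n ^+ 2 + g))).
  rewrite -addrA lerD// ?ler_wpM2l// ?(le_trans ler01)//.
  by rewrite ler_peMl// addr_ge0.
rewrite le_eqVlt; apply/orP; left; apply/eqP.
by rewrite mulrA -exprS -mulrDr /g -natr1; congr (_ * _); ring.
Qed.

(** The increments of the noise [N], jumps included, enter the scheme exactly: only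
the drift integral is approximated. *)
Lemma cvg_euler t : 0 <= t <= T ->
  (fun n => euler n (grid_index n t)) @ \oo --> x t.
Proof.
move=> /andP[t0 tT].
have err n : `|euler n (grid_index n t) - x (grid n (grid_index n t))| <=
    expR (K * T) * (M * mesh n + T * (K * M * mesh n) + G n T) + M * mesh n.
  have d0 := ltW (mesh_gt0 n).
  have rest0 : 0 <= M * mesh n + T * (K * M * mesh n) + G n T.
    by rewrite !addr_ge0// !mulr_ge0// ltW.
  have := @grid_index_le n t; rewrite t0 tT => /(_ isT).
  case: (grid_index n t) => [_|i iin].
    by rewrite /euler/= grid0 subrr normr0; apply: addr_ge0;
      apply: mulr_ge0 => //; exact: expR_ge0.
  have iT : grid n i <= T by rewrite -(grid_max n) grid_le// ltnW.
  apply: le_trans (ler_distD (delayed n i) _ _) _.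
  apply: lerD (delayed_gap n i); apply: (le_trans (euler_error n i)).
  apply: ler_pM.
  - by rewrite exprn_ge0// addr_ge0// mulr_ge0.
  - apply: addr_ge0 => //; apply: addr_ge0; apply: mulr_ge0 => //.
    by rewrite mulr_ge0 ?sqr_ge0// mulr_ge0.
  - have q0 : 0 <= 1 + K * mesh n by rewrite addr_ge0// mulr_ge0.
    apply: (@le_trans _ _ (expR (K * mesh n) ^+ i)).
      by apply: lerXn2r; rewrite ?nnegrE ?expR_ge0//; exact: expR_ge1Dx.
    rewrite -expRM_natl ler_expR mulrCA ler_wpM2l//.
  - rewrite lerD//; last by rewrite -[in leRHS](grid_max n) G_mono// ltnW.
    rewrite lerD2l (_ : i%:R * _ = grid n i * (K * M * mesh n)); last first.
      by rewrite /grid; ring.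
    by rewrite ler_wpM2r// mulr_ge0// mulr_ge0.
pose r n := expR (K * T) * (M * mesh n + T * (K * M * mesh n) + G n T) + M * mesh n.
have r0 : r @ \oo --> 0.
  rewrite [X in _ --> X](_ : 0 =
    expR (K * T) * (M * 0 + T * (K * M * 0) + 0) + M * 0); last by ring.
  have cM c : (fun n => c * mesh n) @ \oo --> c * 0.
    by apply: cvgM; [exact: cvg_cst|exact: cvg_mesh].
  apply: cvgD => //; apply: cvgM; first exact: cvg_cst.
  apply: cvgD; last exact: cvg_gap.
  by apply: cvgD => //; apply: cvgM; [exact: cvg_cst|exact: cM].
have diff0 : (fun n => euler n (grid_index n t) - x (grid n (grid_index n t)))
    @ \oo --> 0.
  apply/norm_cvg0P; apply: (squeeze_cvgr _ (cvg_cst 0) r0).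
  by apply: nearW => n; rewrite normr_ge0 err.
rewrite -[x t]add0r.
rewrite (_ : (fun n => _) = (fun n =>
  (euler n (grid_index n t) - x (grid n (grid_index n t)))
  + x (grid n (grid_index n t)))); last by apply/funext => n; rewrite subrK.
by apply: cvgD => //; exact: cvg_path_grid.
Qed.

End euler_scheme.

(** * Independence of the driving noises *)

Section sigma_families.
Context d (Om : measurableType d) (I : Type) d' (S : measurableType d')
  (D : set I) (Y : I -> Om -> S).

(** [Om] with the sigma-algebra generated by the family: belonging to
[sigma_family] becomes measurability on this space. *)
Definition family_space : Type :=
  g_sigma_algebraType (\bigcup_(i in D) preimage_set_system setT (Y i) measurable).

HB.instance Definition _ := Measurable.on family_space.

Lemma measurable_family i : D i -> measurable_fun setT (Y i : family_space -> S).
Proof.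
by move=> Di _ B mB; apply: sub_sigma_algebra; exists i => //; exists B.
Qed.

Lemma family_preimage d2 (T : measurableType d2) (f : family_space -> T) B :
  measurable_fun setT f -> measurable B -> sigma_family D Y (f @^-1` B).
Proof. by move=> mf mB; rewrite -[_ @^-1` _]setTI; exact: mf. Qed.

Lemma family_measurable (A : set Om) :
  (forall i, D i -> measurable_fun setT (Y i)) -> sigma_family D Y A ->
  measurable A.
Proof.
move=> mY; apply: smallest_sub; first exact: sigma_algebra_measurable.
by move=> _ [i Di [B mB <-]]; exact: mY.
Qed.

Lemma familyI (A A' : set Om) : sigma_family D Y A -> sigma_family D Y A' ->
  sigma_family D Y (A `&` A').
Proof. exact: (@measurableI _ family_space). Qed.

Lemma familyT : sigma_family D Y setT.
Proof. exact: (@measurableT _ family_space). Qed.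

End sigma_families.

(** An integral against a random measure is measurable as soon as the masses of
measurable sets are. The space [S] is arbitrary so that it can be [Om] with the
sigma-algebra generated by these masses, which is the one that independence
speaks of. *)
Lemma measurable_compensated_jumps (R : realType) d (S : measurableType d)
    (nu : S -> {measure set (R * R) -> \bar R}) (gamma : R) (F : R -> R) (t : R) :
  (forall A, measurable A -> measurable_fun setT (fun w => nu w A)) ->
  measurable_fun setT (fun w => compensated_jumps gamma F (nu w) t).
Proof.
move=> mnu; apply: measurable_funB; last exact: measurable_cst.
rewrite /Rintegral; apply: measurableT_comp => //.
set D := `]0, t] `*` _; set f := fun p : R * R => (gamma * p.2)%:E.
have mD : measurable D.
  apply: measurableX => //.
  rewrite (_ : [set z | _] = ~` [set 0 : R]); first exact: measurableC.
  by apply/seteqP; split => z /= /eqP.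
have mf : measurable_fun D f.
  apply/measurable_EFinP/measurable_funTS; apply: measurable_funM => //.
rewrite (_ : (fun w => _) = (fun w => \int[nu w]_p ((f^\+ \_ D) p) -
    \int[nu w]_p ((f^\- \_ D) p))%E); last first.
  by apply/funext => w; rewrite integralE !(integral_mkcond D).
apply: emeasurable_funB; apply: measurable_fun_integral_kernel => //.
- by move=> z; rewrite patchE; case: ifP.
- exact: ((measurable_restrictT _ mD).1 (measurable_funepos mf)).
- by move=> z; rewrite patchE; case: ifP.
- exact: ((measurable_restrictT _ mD).1 (measurable_funeneg mf)).
Qed.

Section driving_noise.
Context d (Om : measurableType d) (R : realType) (P : probability Om R).
Variables (T : R) (n : nat) (B Xc : R -> Om -> R)
  (nu : Om -> {measure set (R * R) -> \bar R}).
Hypotheses (T0 : 0 < T) (HB : brownian_motion P B)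
  (mX0 : measurable_fun setT (Xc 0))
  (mnu : forall A, measurable A -> measurable_fun setT (fun w => nu w A))
  (ind : independent3 P (sigma_family [set 0] Xc)
     (sigma_family [set t | 0 <= t] B)
     (sigma_family measurable (fun A w => nu w A))).

Local Notation famB := (family_space [set t : R | 0 <= t] B).
Local Notation famN := (family_space measurable (fun A w => nu w A)).

(** Chains are indexed by all of [nat], hence the value 0 past the last step. *)
Definition increment (j : nat) (w : Om) : R :=
  if (j < n.+1)%N then B (grid T n j.+1) w - B (grid T n j) w else 0.

Let mB t : 0 <= t -> measurable_fun setT (B t).
Proof. by case: HB => mB _ _ _ _; exact: mB. Qed.

Lemma measurable_increment_fam j : measurable_fun setT (increment j : famB -> R).
Proof.
rewrite /increment; case: (j < n.+1)%N; last exact: measurable_cst.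
by apply: measurable_funB; apply: measurable_family; exact: grid_ge0.
Qed.

Lemma measurable_increment j : measurable_fun setT (increment j).
Proof.
rewrite /increment; case: (j < n.+1)%N; last exact: measurable_cst.
by apply: measurable_funB; apply: mB; exact: grid_ge0.
Qed.

Lemma famX_measurable A : sigma_family [set 0] Xc A -> measurable A.
Proof. by apply: family_measurable => _ ->. Qed.

Lemma famB_measurable A : sigma_family [set t | 0 <= t] B A -> measurable A.
Proof. by apply: family_measurable => t /= t0; exact: mB. Qed.

Lemma famN_measurable A : sigma_family measurable (fun A w => nu w A) A -> measurable A.
Proof. by apply: family_measurable. Qed.

Definition box (C : nat -> set R) : set Om :=
  \bigcap_(i : 'I_n.+1) (increment i @^-1` C i).

Lemma box_fam C : (forall j, measurable (C j)) ->
  sigma_family [set t | 0 <= t] B (box C).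
Proof.
move=> mC; apply: (@fin_bigcap_measurable _ famB) => // i _.
exact: family_preimage (measurable_increment_fam i) (mC i).
Qed.

Lemma box_prob C : (forall j, measurable (C j)) ->
  P (box C) = (\prod_(i < n.+1) P (increment i @^-1` C i))%E.
Proof.
move=> mC; case: HB => _ _ _ _ /(_ n.+1 (grid T n)) H.
have := H (grid_ge0 T0 n 0) (fun i => grid_le T0 n (leqnSn i)) _
  (fun i : 'I_n.+1 => mC i).
have E (i : 'I_n.+1) : increment i = (fun w => B (grid T n i.+1) w - B (grid T n i) w).
  by apply/funext => w; rewrite /increment ltn_ord.
move=> {}H; transitivity (P (\bigcap_(i : 'I_n.+1)
    ((fun w => B (grid T n i.+1) w - B (grid T n i) w) @^-1` C i))).
  by congr (P _); apply: eq_bigcapr => i _; rewrite -E.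
rewrite H; apply: eq_bigr => i _; by rewrite E.
Qed.

Lemma increment_law k A : (k < n.+1)%N -> measurable A ->
  P (increment k @^-1` A) = normal_prob 0 (Num.sqrt (mesh T n)) A.
Proof.
move=> kn mA; case: HB => _ _ _ /(_ (grid T n k) (grid T n k.+1)) H _.
have := H (grid_ge0 T0 n k) _ A mA.
rewrite gridS addrAC subrr add0r ltrDl mesh_gt0// => /(_ isT) <-.
by congr (P _); apply/seteqP; split => w /=; rewrite /increment kn gridS.
Qed.

(** A pi-system for everything but the k-th increment, which the condition
[C k = setT] leaves free. *)
Definition rest k : set (set Om) :=
  [set A | exists A1 A3 C, [/\ sigma_family [set 0] Xc A1,
     sigma_family measurable (fun A w => nu w A) A3,
     (forall j, measurable (C j)), C k = setT & A = A1 `&` box C `&` A3]].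

Lemma rest_measurable k A : rest k A -> measurable A.
Proof.
case=> A1 [A3 [C [h1 h3 mC _ ->]]].
apply: measurableI; last exact: famN_measurable.
apply: measurableI; first exact: famX_measurable.
by apply: famB_measurable; exact: box_fam.
Qed.

Lemma restI k : setI_closed (rest k).
Proof.
move=> _ _ [A1 [A3 [C [h1 h3 mC Ck ->]]]] [A1' [A3' [C' [h1' h3' mC' Ck' ->]]]].
exists (A1 `&` A1'), (A3 `&` A3'), (fun j => C j `&` C' j); split.
- exact: familyI.
- exact: familyI.
- by move=> j; exact: measurableI.
- by rewrite Ck Ck' setIT.
- rewrite (_ : box (fun j => C j `&` C' j) = box C `&` box C').
    by apply/seteqP; split => w; rewrite /setI/=; tauto.
  by rewrite /box -bigcapI.
Qed.

Lemma boxT : box (fun=> setT) = setT.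
Proof. by apply/seteqP; split. Qed.

Lemma restT k : rest k setT.
Proof.
exists setT, setT, (fun=> setT); split => //; rewrite ?boxT ?setIT//.
- exact: familyT.
- exact: familyT.
Qed.

(** The event on the k-th increment fills the free slot of the box, and both sides
factor by the independence of the three noises and of the increments. *)
Lemma rest_indep k A C0 : (k < n.+1)%N -> rest k A -> measurable C0 ->
  P (A `&` increment k @^-1` C0) =
  (P A * normal_prob 0 (Num.sqrt (mesh T n)) C0)%E.
Proof.
move=> kn [A1 [A3 [C [h1 h3 mC Ck ->]]]] mC0.
pose C' j := if j == k then C0 else C j.
have mC' j : measurable (C' j) by rewrite /C'; case: ifP.
have boxE : box C `&` increment k @^-1` C0 = box C'.
  rewrite /box; apply/seteqP; split => w.
  - move=> [wC wk] i _; rewrite /= /C'; case: eqP => [->//|_]; exact: wC.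
  - move=> wC'; split => [i _|]; have := wC' (Ordinal kn) I; last first.
      by rewrite /= /C' eqxx.
    have := wC' i I; rewrite /= /C'; case: eqP => [ik _ _|//].
    by rewrite ik Ck.
rewrite -setIA (setIC A3) setIA -(setIA A1) boxE.
rewrite !ind//; try exact: box_fam.
rewrite -!muleA; congr (_ * _)%E; rewrite (muleC (P A3)) muleA; congr (_ * _)%E.
rewrite !box_prob// (bigD1 (Ordinal kn))//= [in RHS](bigD1 (Ordinal kn))//=.
rewrite Ck preimage_setT probability_setT mul1e /C' eqxx increment_law// muleC.
congr (_ * _)%E; apply: eq_bigr => i; rewrite -val_eqE /= => /negbTE ik.
by rewrite ik.
Qed.

Local Notation grest k := (g_sigma_algebraType (rest k)).

Lemma measurable_start_rest k : measurable_fun setT (Xc 0 : grest k -> R).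
Proof.
move=> _ C mC; apply: sub_sigma_algebra; rewrite setTI.
exists (Xc 0 @^-1` C), setT, (fun=> setT); split => //.
- apply: (@family_preimage _ _ _ _ _ [set 0] Xc _ _ (Xc 0) C _ mC).
  exact: measurable_family.
- exact: familyT.
- by rewrite boxT !setIT.
Qed.

Lemma measurable_jump_rest k (f : Om -> R) : measurable_fun setT (f : famN -> R) ->
  measurable_fun setT (f : grest k -> R).
Proof.
move=> mf _ C mC; apply: sub_sigma_algebra; rewrite setTI.
exists setT, (f @^-1` C), (fun=> setT); split => //.
- exact: familyT.
- exact: family_preimage mf mC.
- by rewrite boxT !setTI.
Qed.

Lemma measurable_increment_rest k j : j != k ->
  measurable_fun setT (increment j : grest k -> R).
Proof.
move=> jk; have [jn|jn] := boolP (j < n.+1)%N; last first.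
  rewrite /increment (negbTE jn); exact: measurable_cst.
move=> _ C mC; apply: sub_sigma_algebra; rewrite setTI.
exists setT, setT, (fun i => if i == j then C else setT); split => //.
- exact: familyT.
- exact: familyT.
- by move=> i; case: ifP.
- by rewrite eq_sym (negbTE jk).
- rewrite setIT setTI; apply/seteqP; split => w /=.
  + by move=> wC i _ /=; case: eqP => [->|].
  + by move=> /(_ (Ordinal jn) I); rewrite /= eqxx.
Qed.

End driving_noise.

(** * Comparing a solution with its translate *)

Section initial_shift.
Context {R : realType}.
Local Notation leb := (@lebesgue_measure R).

(** For a probability density, the total variation distance to its translate. *)
Definition shift_loss (m : R -> R) (h : R) : \bar R :=
  (\int[leb]_u (Num.max 0 (m u - m (u + h)%R))%:E)%E.

(** With values in [0, 1], [psi (u + h) * m u] is at most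
[psi (u + h) * m (u + h)] plus the positive part of [m u - m (u + h)], and a
translation turns the first term into the expectation without shift. *)
Lemma integral_initial_shift d (Om : measurableType d) (P : probability Om R)
    (G : set (set Om)) (U : Om -> R) (m : R -> R) (h : R)
    (psi : g_sigma_algebraType G * measurableTypeR R -> R) :
  (forall A, G A -> measurable A) -> setI_closed G -> G setT ->
  measurable_fun setT U ->
  (forall A C, G A -> measurable C ->
     P (A `&` U @^-1` C) = (P A * P (U @^-1` C))%E) ->
  has_density (fun A => P (U @^-1` A)) m ->
  measurable_fun setT psi -> (forall p, 0 <= psi p <= 1) ->
  (\int[P]_w (psi (w, U w + h)%R)%:E <=
   shift_loss m h + \int[P]_w (psi (w, U w))%:E)%E.
Proof.
move=> Gm GI GT mU ind [mm m0 dens] mpsi psi01.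
have psi0 p : 0 <= psi p by case/andP: (psi01 p).
have mU' : measurable_fun setT (U : Om -> measurableTypeR R) by [].
pose pi := law P mU'.
have mh : measurable_fun setT (fun u : R => u + h) by exact: measurable_addr.
have mpsih : measurable_fun setT
    (fun p : g_sigma_algebraType G * measurableTypeR R => psi (p.1, p.2 + h)).
  apply: (measurableT_comp mpsi); apply: measurable_fun_pair => //.
  exact: (measurableT_comp mh).
have mEpsi : measurable_fun setT (EFin \o psi) by exact/measurable_EFinP.
have mEpsih : measurable_fun setT
    (fun p : g_sigma_algebraType G * measurableTypeR R => (psi (p.1, p.2 + h)%R)%:E).
  exact/measurable_EFinP.
rewrite (@integral_freezing _ _ _ P _ (measurableTypeR R) G U pi Gm GI GT mU' ind
  _ mEpsih); last by move=> p; rewrite lee_fin.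
rewrite (@integral_freezing _ _ _ P _ (measurableTypeR R) G U pi Gm GI GT mU' ind
  _ mEpsi); last by move=> p; rewrite lee_fin.
have loss0 : (0 <= shift_loss m h)%E.
  by apply: integral_ge0 => u _; rewrite lee_fin le_max lexx.
have mpsiw w : measurable_fun setT (fun u : measurableTypeR R => psi (w, u)).
  by apply: (measurableT_comp mpsi); exact: measurable_fun_pair.
have densE (f : R -> R) : measurable_fun setT f -> (forall u, 0 <= f u) ->
    (\int[pi]_u (f u)%:E = \int[leb]_u ((f u)%:E * (m u)%:E))%E.
  move=> mf f0.
  apply: (@ge0_integral_density _ _ _ pi leb m (fun u => (f u)%:E) mm m0 dens) => //.
  exact/measurable_EFinP.
have mmh : measurable_fun setT (fun u : R => m (u + h)) by exact: (measurableT_comp mm mh).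
have mloss : measurable_fun setT (fun u : R => Num.max 0 (m u - m (u + h))).
  by apply: measurable_maxr => //; exact: measurable_funB.
have inner w : (\int[pi]_u (psi (w, u + h)%R)%:E <=
    shift_loss m h + \int[pi]_u (psi (w, u))%:E)%E.
  rewrite (densE (fun u => psi (w, u + h)))//; last exact: (measurableT_comp (mpsiw w) mh).
  rewrite (densE (fun u => psi (w, u)))//; last exact: (mpsiw w).
  rewrite -(@ge0_integral_translation R h (fun u => (psi (w, u))%:E * (m u)%:E)%E).
  - rewrite -ge0_integralD//.
    + apply: ge0_le_integral => //.
      * by move=> u _; rewrite -EFinM lee_fin mulr_ge0.
      * apply: emeasurable_funM; apply/measurable_EFinP => //.
        exact: (measurableT_comp (mpsiw w) mh).
      * apply: emeasurable_funD; first exact/measurable_EFinP.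
        apply: emeasurable_funM; apply/measurable_EFinP => //.
        exact: (measurableT_comp (mpsiw w) mh).
      * move=> u _; rewrite -!EFinM -EFinD lee_fin.
        have /andP[p0 p1] := psi01 (w, u + h).
        set p := psi _ in p0 p1 *; set x := m u; set y := m (u + h).
        have : p * (x - y) <= Num.max 0 (x - y).
          rewrite le_max; have [xy|xy] := leP 0 (x - y).
            by apply/orP; right; rewrite ler_piMl.
          by apply/orP; left; rewrite mulr_ge0_le0// ltW.
        lra.
    + by move=> u _; rewrite lee_fin le_max lexx.
    + exact/measurable_EFinP.
    + by move=> u _; rewrite -EFinM lee_fin mulr_ge0.
    + apply: emeasurable_funM; apply/measurable_EFinP => //.
      exact: (measurableT_comp (mpsiw w) mh).
  - by apply: emeasurable_funM; apply/measurable_EFinP => //; exact: (mpsiw w).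
  - by move=> u; rewrite -EFinM lee_fin mulr_ge0.
have mint : measurable_fun setT (fun w : g_sigma_algebraType G =>
    \int[pi]_u (psi (w, u))%:E)%E.
  apply: (@measurable_fun_fubini_tonelli_F _ _ _ _ _ pi (EFin \o psi)).
    exact/measurable_EFinP.
  by move=> p; rewrite lee_fin.
have minth : measurable_fun setT (fun w : g_sigma_algebraType G =>
    \int[pi]_u (psi (w, u + h)%R)%:E)%E.
  apply: (@measurable_fun_fubini_tonelli_F _ _ _ _ _ pi (fun p => (psi (p.1, p.2 + h)%R)%:E)).
    exact/measurable_EFinP.
  by move=> p; rewrite lee_fin.
apply: (@le_trans _ _ (\int[P]_w (shift_loss m h + \int[pi]_u (psi (w, u))%:E)%E)%E).
  apply: ge0_le_integral => //.
  - by move=> w _; apply: integral_ge0 => u _; rewrite lee_fin.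
  - exact: (measurable_to_g_sigma Gm minth).
  - apply: emeasurable_funD => //; exact: (measurable_to_g_sigma Gm mint).
  - by move=> w _; exact: inner.
rewrite ge0_integralD//.
- by rewrite integral_cst//= probability_setT mule1.
- by move=> w _; apply: integral_ge0 => u _; rewrite lee_fin.
- exact: (measurable_to_g_sigma Gm mint).
Qed.

End initial_shift.

Section cylinder_inequality.
Context d (Om : measurableType d) (R : realType) (P : probability Om R).
Variables (T K M a gamma h : R) (F b m : R -> R) (B : R -> Om -> R)
  (nu : Om -> {measure set (R * R) -> \bar R}) (X : Om -> cadlag_path R).
Hypotheses (T0 : 0 < T) (K0 : 0 <= K) (M0 : 0 <= M) (a0 : a != 0)
  (Kb : forall u v, `|b u - b v| <= K * `|u - v|) (Mb : forall u, `|b u| <= M)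
  (sol : solution a gamma F b P B nu X)
  (dens : has_density (marginal P X 0) m).

Let Xc t w := path_at t (X w).
Let J t w := compensated_jumps gamma F (nu w) t.
Let kappa := K * `|h| / `|a|.

Let mX t : 0 <= t -> measurable_fun setT (Xc t).
Proof. by case: sol => _ _ + _ _; exact. Qed.

Let mnu A : measurable A -> measurable_fun setT (fun w => nu w A).
Proof. by case: sol => _ [mnu _ _] _ _ _; exact: mnu. Qed.

Let HB : brownian_motion P B. Proof. by case: sol. Qed.

Let ind : independent3 P (sigma_family [set 0] Xc)
     (sigma_family [set t | 0 <= t] B)
     (sigma_family measurable (fun A w => nu w A)).
Proof. by case: sol. Qed.

Definition euler_noise n j w :=
  a * increment T n B j w + (J (grid T n j.+1) w - J (grid T n j) w).

Definition euler_path n w t :=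
  chain (fun _ y => mesh T n * b y) (fun j => euler_noise n j w) (Xc 0 w)
    (grid_index T n t).

Let mb : measurable_fun setT b.
Proof. by apply: continuous_measurable_fun; exact: (continuous_drift K0 Kb). Qed.

Let mJ_fam t : measurable_fun setT
  (J t : family_space measurable (fun A w => nu w A) -> R).
Proof.
apply: measurable_compensated_jumps => A mA.
exact: (@measurable_family _ _ _ _ _ measurable (fun A w => nu w A) A mA).
Qed.

Let famN_sub A := @famN_measurable _ _ _ nu mnu A.

Let mJ t : measurable_fun setT (J t).
Proof.
move=> _ C mC; rewrite setTI; apply: famN_sub.
exact: family_preimage (mJ_fam t) mC.
Qed.

Let mnoise n j : measurable_fun setT (euler_noise n j).
Proof.
apply: measurable_funD; last exact: measurable_funB.
by apply: measurable_funM => //; exact: (measurable_increment _ T0 HB).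
Qed.

Lemma measurable_euler_path n t : measurable_fun setT (fun w => euler_path n w t).
Proof.
apply: (@measurable_chain _ _ _ (fun _ y => mesh T n * b y) (euler_noise n)) => //.
- by move=> _; exact: measurable_funM.
- exact: mX.
Qed.

Lemma cvg_euler_path :
  {ae P, forall w, forall t, 0 <= t <= T ->
    (fun n => euler_path n w t) @ \oo --> Xc t w}.
Proof.
have [_ _ _ _ +] := sol; apply: filterS => w eqn t tT.
pose N t := a * B t w + J t w.
have [rc _] : cadlag (set_val (X w)) by exact: set_mem (valP (X w)).
have eqn' s : 0 <= s -> Xc s w =
    Xc 0 w + \int[lebesgue_measure]_(u in `[0, s]) b (Xc u w) + N s.
  by move=> s0; rewrite /N addrA; exact: eqn.
have := @cvg_euler _ T K M b (fun s => Xc s w) N T0 K0 M0 Kb Mb rc eqn' t tT.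
apply: cvg_trans; apply: near_eq_cvg; apply: nearW => n.
apply: eq_chain => // j jt; rewrite /N /euler_noise /increment.
rewrite (leq_trans jt (grid_index_le T0 n tT)) /J; ring.
Qed.

Lemma measurable_cylinder_grid n g : cylinder T g ->
  pathwise_measurable (fun e => g (fun t => e (grid_index T n t))).
Proof.
move=> cg d' S e me.
exact: (measurable_cylinder (e := fun t w => e (grid_index T n t) w) cg).
Qed.

(** A pi-system generating the Brownian and jump noises together. *)
Let noise_sigma : set (set Om) :=
  [set A | exists A2 A3, [/\ sigma_family [set t | 0 <= t] B A2,
     sigma_family measurable (fun A w => nu w A) A3 & A = A2 `&` A3]].

Let noise_sigma_measurable A : noise_sigma A -> measurable A.
Proof.
move=> [A2 [A3 [h2 h3 ->]]]; apply: measurableI; last exact: famN_sub.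
exact: (famB_measurable HB).
Qed.

Let noise_sigmaI : setI_closed noise_sigma.
Proof.
move=> _ _ [A2 [A3 [h2 h3 ->]]] [A2' [A3' [h2' h3' ->]]].
exists (A2 `&` A2'), (A3 `&` A3'); split; [exact: familyI|exact: familyI|].
by rewrite setIACA.
Qed.

Let noise_sigmaT : noise_sigma setT.
Proof. by exists setT, setT; split; rewrite ?setIT//; exact: familyT. Qed.

Let mnoise_sigma n j :
  measurable_fun setT (euler_noise n j : g_sigma_algebraType noise_sigma -> R).
Proof.
apply: measurable_funD.
  apply: measurable_funM => // _ C mC; rewrite setTI; apply: sub_sigma_algebra.
  exists (increment T n B j @^-1` C), setT; split; rewrite ?setIT//.
    apply: (@family_preimage _ _ _ _ _ [set t | 0 <= t] B _ _ (increment T n B j) C _ mC).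
    exact: measurable_increment_fam.
  exact: familyT.
have mJs t : measurable_fun setT (J t : g_sigma_algebraType noise_sigma -> R).
  move=> _ C mC; rewrite setTI; apply: sub_sigma_algebra.
  exists setT, (J t @^-1` C); split; rewrite ?setTI//; first exact: familyT.
  exact: family_preimage (mJ_fam t) mC.
exact: measurable_funB.
Qed.

Let start_indep A C : noise_sigma A -> measurable C ->
  P (A `&` Xc 0 @^-1` C) = (P A * P (Xc 0 @^-1` C))%E.
Proof.
move=> [A2 [A3 [h2 h3 ->]]] mC.
have h1 : sigma_family [set 0] Xc (Xc 0 @^-1` C).
  apply: (@family_preimage _ _ _ _ _ [set 0] Xc _ _ (Xc 0) C _ mC).
  exact: measurable_family.
have hT : sigma_family [set 0] Xc setT by exact: familyT.
rewrite setIC setIA ind// -[in X in (_ = X * _)%E](setTI A2) ind//.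
by rewrite probability_setT mul1e -muleA muleC.
Qed.

(** Translating the chain by [h] amounts to starting it [h] further and replacing
[b] by [b (_ - h)]. The first change costs at most [shift_loss m h], the second
is a change of drift by at most [K * h]. *)
Lemma euler_comparison n g : cylinder T g ->
  (\int[P]_w (g (fun t => euler_path n w t + h))%:E <=
   shift_loss m h + ((1 / 4)%:E +
   (expR (kappa ^+ 2 * T))%:E * \int[P]_w (g (euler_path n w))%:E))%E.
Proof.
move=> cg.
have d0 := mesh_gt0 T0 n.
pose s := Num.sqrt (mesh T n).
have s0 : 0 < s by rewrite sqrtr_gt0.
have s2 : s ^+ 2 = mesh T n by rewrite sqr_sqrtr// ltW.
pose f0 y := mesh T n * b y; pose f1 y := mesh T n * b (y - h).
pose th y := (b (y - h) - b y) / a.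
have mbh : measurable_fun setT (fun y : R => b (y - h)).
  by apply: measurableT_comp => //; exact: measurable_addr.
have mf0 : measurable_fun setT f0 by exact: measurable_funM.
have mf1 : measurable_fun setT f1 by exact: measurable_funM.
have mth : measurable_fun setT th by apply: measurable_funM => //; exact: measurable_funB.
have f1E y : f1 y = f0 y + a * (th y * s ^+ 2).
  by rewrite s2 /f1 /f0 /th; field.
have thk y : `|th y| <= kappa.
  rewrite /th normrM normfV /kappa ler_wpM2r ?invr_ge0//.
  by rewrite (le_trans (Kb _ _))// (_ : y - h - y = - h) ?normrN//; ring.
pose Psi e := g (fun t => e (grid_index T n t)).
have mPsi : pathwise_measurable Psi by exact: measurable_cylinder_grid.
have Psi01 e : 0 <= Psi e <= 1 by exact: cylinder01 cg.
pose V j w := J (grid T n j.+1) w - J (grid T n j) w.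
have stepA : (\int[P]_w (g (fun t => euler_path n w t + h))%:E <=
    shift_loss m h +
    \int[P]_w (Psi (chain (fun=> f1) (euler_noise n ^~ w) (Xc 0 w)))%:E)%E.
  pose psi (p : g_sigma_algebraType noise_sigma * measurableTypeR R) :=
    Psi (chain (fun=> f1) (euler_noise n ^~ p.1) p.2).
  have mpsi : measurable_fun setT psi.
    pose S : measurableType _ := (g_sigma_algebraType noise_sigma * measurableTypeR R)%type.
    apply: (mPsi _ _ (fun i (p : S) =>
      chain (fun=> f1) (euler_noise n ^~ p.1) p.2 i)) => i.
    apply: (@measurable_chain _ _ _ (fun=> f1)
      (fun j (p : S) => euler_noise n j p.1) (fun p => p.2)) => //.
    by move=> j; exact: (measurableT_comp (mnoise_sigma n j)).
    exact: measurable_snd.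
  have := @integral_initial_shift _ _ _ P noise_sigma (Xc 0) m h psi
    noise_sigma_measurable noise_sigmaI noise_sigmaT (mX (lexx 0)) start_indep
    dens mpsi (fun p => Psi01 _).
  apply: le_trans; rewrite le_eqVlt; apply/orP; left; apply/eqP.
  apply: eq_integral => w _; rewrite /psi /Psi /=; congr (g _)%:E.
  apply/funext => t; rewrite /euler_path -(chain_translation (fun=> f0)).
  by [].
apply: (le_trans stepA); rewrite leeD2l//.
have mX0 := mX (lexx 0).
have mV k j : measurable_fun setT (V j : g_sigma_algebraType (rest T n B Xc nu k) -> R).
  by apply: measurable_jump_rest; apply: measurable_funB; exact: mJ_fam.
have cd := @change_of_drift _ _ _ P a s kappa f0 f1 th n.+1 (increment T n B) V (Xc 0)
  (fun k => rest T n B Xc nu k) s0 mf0 mth f1E thk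
  (fun k A => @rest_measurable _ _ _ P T n B Xc nu T0 HB mX0 mnu k A)
  (fun k => @restI _ _ _ T n B Xc nu k)
  (fun k => @restT _ _ _ T n B Xc nu k)
  (@measurable_increment _ _ _ P T n B T0 HB)
  (fun k A C => @rest_indep _ _ _ P T n B Xc nu T0 HB ind k A C)
  (fun k => @measurable_start_rest _ _ _ T n B Xc nu k)
  mV
  (fun k j => @measurable_increment_rest _ _ _ T n B Xc nu k j)
  Psi mPsi Psi01.
have -> : kappa ^+ 2 * T = kappa ^+ 2 * s ^+ 2 * n.+1%:R.
  rewrite s2 -mulrA; congr (_ * _); rewrite mulrC.
  exact: esym (grid_max T n).
apply: le_trans (le_trans cd _).
  rewrite le_eqVlt; apply/orP; left; apply/eqP.
  apply: eq_integral => w _; congr (Psi _)%:E; apply/funext => i.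
rewrite leeD2l// lee_wpmul2l ?lee_fin ?expR_ge0//.
rewrite le_eqVlt; apply/orP; left; apply/eqP.
apply: eq_integral => w _; congr _%:E; apply: (eq_cylinder cg) => t tT.
apply: eq_chain => // j y jt; rewrite /hybrid.
by rewrite (leq_trans jt (grid_index_le T0 n tT)).
Qed.

(** The mesh of [euler_comparison] tends to 0; its constants do not depend on it. *)
Lemma cylinder_inequality (e : R) g : (shift_loss m h <= e%:E)%E ->
  cylinder T g ->
  (\int[P]_w (g (fun t => path_at t (X w) + h))%:E <= (e + 1 / 4)%:E +
   (expR (kappa ^+ 2 * T))%:E * \int[P]_w (g (fun t => path_at t (X w)))%:E)%E.
Proof.
move=> losse cg.
have mXt t : 0 <= t <= T -> measurable_fun setT (Xc t) by case/andP => t0 _; exact: mX.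
have g01 x : `|g x| <= 1.
  by have /andP[? ?] := cylinder01 x cg; rewrite ger0_norm.
have cvg1 : (\int[P]_w (g (euler_path n w))%:E)%E @[n --> \oo] -->
    (\int[P]_w (g (fun t => Xc t w))%:E)%E.
  apply: (@bounded_convergence _ _ _ P (fun n w => g (euler_path n w))
    (fun w => g (fun t => Xc t w)) 1) => //.
  - move=> n; apply: (measurable_cylinder (e := fun t w => euler_path n w t) cg).
    by move=> t _; exact: measurable_euler_path.
  - exact: (measurable_cylinder (e := Xc) cg mXt).
  - apply: filterS cvg_euler_path => w cw; exact: (cvg_cylinder cg cw).
have cvg2 : (\int[P]_w (g (fun t => euler_path n w t + h))%:E)%E @[n --> \oo] -->
    (\int[P]_w (g (fun t => Xc t w + h))%:E)%E.
  apply: (@bounded_convergence _ _ _ P (fun n w => g (fun t => euler_path n w t + h))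
    (fun w => g (fun t => Xc t w + h)) 1) => //.
  - move=> n; apply: (measurable_cylinder (e := fun t w => euler_path n w t + h) cg).
    by move=> t _; apply: measurable_funD => //; exact: measurable_euler_path.
  - apply: (measurable_cylinder (e := fun t w => Xc t w + h) cg) => t tT.
    by apply: measurable_funD => //; exact: mXt.
  - apply: filterS cvg_euler_path => w cw; apply: (cvg_cylinder cg) => t tT.
    by apply: cvgD; [exact: cw|exact: cvg_cst].
have fin2 : (\int[P]_w (g (fun t => Xc t w))%:E)%E \is a fin_num.
  rewrite ge0_fin_numE; last first.
    by apply: integral_ge0 => w _; rewrite lee_fin; case/andP: (cylinder01 (Xc ^~ w) cg).
  apply: (@le_lt_trans _ _ (\int[P]_w (cst 1%E w))%E); last first.
    by rewrite integral_cst// mul1e (le_lt_trans (probability_le1 P measurableT))// ltry.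
  apply: ge0_le_integral => //.
  - by move=> w _; rewrite lee_fin; case/andP: (cylinder01 (Xc ^~ w) cg).
  - by apply/measurable_EFinP; exact: (measurable_cylinder (e := Xc) cg mXt).
  - by move=> w _; rewrite lee_fin; case/andP: (cylinder01 (Xc ^~ w) cg).
have cvg3 : ((e + 1 / 4)%:E + (expR (kappa ^+ 2 * T))%:E
      * \int[P]_w (g (euler_path n w))%:E)%E @[n --> \oo] -->
    ((e + 1 / 4)%:E + (expR (kappa ^+ 2 * T))%:E
      * \int[P]_w (g (fun t => Xc t w))%:E)%E.
  apply: cvgeD; [by rewrite fin_num_adde_defr|exact: cvg_cst|].
  by apply: cvgeZl => //.
rewrite -(cvg_lim _ cvg2)// -(cvg_lim _ cvg3)//.
apply: lee_lim; [by apply/cvg_ex; eexists; exact: cvg2|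
  by apply/cvg_ex; eexists; exact: cvg3|].
apply: nearW => n; apply: (le_trans (euler_comparison n cg)).
by rewrite EFinD -(addeA e%:E); exact: leeD2r.
Qed.

End cylinder_inequality.

(** * Translation invariance of the model *)

Section translated_model.
Context {R : realType}.
Local Notation leb := (@lebesgue_measure R).

Lemma cadlag_addr (c : R) (w : cadlag_path R) :
  (fun t => path_at t w + c) \in @cadlag R.
Proof.
have [rc lc] : cadlag (set_val w) by exact: set_mem (valP w).
apply/mem_set; split => t t0.
  by apply: cvgD; [exact: rc|exact: cvg_cst].
by apply: is_cvgD; [exact: lc|exact: is_cvg_cst].
Qed.

Definition shift_path (c : R) (w : cadlag_path R) : cadlag_path R :=
  SigSub (cadlag_addr c w).

Lemma path_at_shift c t w : path_at t (shift_path c w) = path_at t w + c.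
Proof. by []. Qed.

(** The noise being additive, translating a solution translates its drift. *)
Lemma solution_translation (a gamma c : R) (F b b' : R -> R)
    d (Om : measurableType d) (P : probability Om R)
    (B : R -> Om -> R) (nu : Om -> {measure set (R * R) -> \bar R})
    (X : Om -> cadlag_path R) :
  (forall x, b' (x + c) = b x) ->
  solution a gamma F b P B nu X ->
  solution a gamma F b' P B nu (fun w => shift_path c (X w)).
Proof.
move=> bb' [HB Hnu mX ind eqn]; split => //.
- by move=> t t0; apply: measurable_funD => //; exact: mX.
- move=> A1 A2 A3 h1; apply: ind; move: A1 h1.
  apply: smallest_sub; first exact: smallest_sigma_algebra.
  move=> _ [t t0 [C mC <-]]; apply: sub_sigma_algebra; exists t => //.
  exists ((fun x => x + c) @^-1` C) => //.
  by rewrite -[X in measurable X]setTI; exact: (measurable_addr c).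
- apply: filterS eqn => w eqn t t0.
  have -> : \int[leb]_(s in `[0, t]) b' (path_at s (shift_path c (X w))) =
      \int[leb]_(s in `[0, t]) b (path_at s (X w)).
    by apply: eq_Rintegral => s _; rewrite path_at_shift bb'.
  by rewrite !path_at_shift eqn//; ring.
Qed.

Lemma has_density_translation (pi pi' : set R -> \bar R) (m : R -> R) (c : R) :
  (forall A, measurable A -> pi' A = pi ((fun x => x + c) @^-1` A)) ->
  has_density pi m -> has_density pi' (fun x => m (x - c)).
Proof.
move=> pi'E [mm m0 dens].
have mc : measurable_fun setT (fun x : R => m (x - c)).
  by apply: (measurableT_comp mm); exact: measurable_addr.
split => // A mA.
have mA' : measurable ((fun x => x + c) @^-1` A).
  by rewrite -[X in measurable X]setTI; exact: (measurable_addr c).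
rewrite pi'E// dens// integral_mkcond [RHS]integral_mkcond.
rewrite -[RHS](ge0_integral_translation c).
- apply: eq_integral => x _; rewrite !patchE /= addrK.
  have -> // : (x \in (fun x => x + c) @^-1` A) = (x + c \in A).
  by apply/idP/idP => /set_mem xA; apply/mem_set.
- have mcA : measurable_fun A (fun x : R => (m (x - c))%:E).
    by apply/measurable_EFinP; exact: measurable_funTS.
  exact: ((measurable_restrictT (fun x : R => (m (x - c))%:E) mA).1 mcA).
- by move=> x; rewrite patchE; case: ifP => _ //; rewrite lee_fin.
Qed.

(** A solution with drift [b'] translated by [- c] has drift [b], and the
invariance of [pi] applies to it. *)
Lemma invariant_translation (a gamma c : R) (F b b' : R -> R)
    (pi pi' : probability R R) :
  (forall x, b' (x + c) = b x) ->
  (forall A, measurable A -> pi' A = pi ((fun x => x + c) @^-1` A)) ->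
  invariant_distribution a gamma F b pi ->
  invariant_distribution a gamma F b' pi'.
Proof.
move=> bb' pi'E inv d Om P B nu X sol X0 t t0 A mA.
have sol' : solution a gamma F b P B nu (fun w => shift_path (- c) (X w)).
  by apply: solution_translation sol => x; rewrite -bb' subrK.
have margE s C : marginal P (fun w => shift_path (- c) (X w)) s ((fun x => x + c) @^-1` C)
    = marginal P X s C.
  by congr (P _); apply/seteqP; split => w /=; rewrite path_at_shift subrK.
rewrite -margE pi'E//; apply: (inv _ _ _ _ _ _ sol') => //; last first.
  by rewrite -[X in measurable X]setTI; exact: (measurable_addr c).
move=> C mC.
have mC' : measurable ((fun x => x - c) @^-1` C).
  by rewrite -[X in measurable X]setTI; exact: (measurable_addr (- c)).
have -> : C = (fun x => x + c) @^-1` ((fun x => x - c) @^-1` C).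
  by apply/seteqP; split => x /=; rewrite addrK.
by rewrite margE X0// pi'E.
Qed.

(** Uniqueness is transported backwards: an invariant law for [b'] moved by [- c]
is invariant for [b]. *)
Lemma unique_invariant_density_translation (a gamma c : R) (F b b' m : R -> R) :
  (forall x, b' (x + c) = b x) ->
  unique_invariant_density a gamma F b m ->
  unique_invariant_density a gamma F b' (fun x => m (x - c)).
Proof.
move=> bb' [pi [inv uniq dens]].
have b'b x : b (x - c) = b' x by rewrite -bb' subrK.
exists (law pi (measurable_addr c)); split.
- exact: (invariant_translation (pi' := law pi (measurable_addr c)) bb'
    (fun A _ => lawE pi (measurable_addr c) A) inv).
- move=> pi' inv' A mA.
  pose pi'' := law pi' (measurable_addr (- c)).
  have inv'' : invariant_distribution a gamma F b pi''.
    exact: (invariant_translation (c := - c) b'b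
      (fun A _ => lawE pi' (measurable_addr (- c)) A) inv').
  have mcA : measurable ((fun x => x + c) @^-1` A).
    by rewrite -[X in measurable X]setTI; exact: (measurable_addr c).
  apply: etrans (uniq _ inv'' _ mcA).
  rewrite [RHS](_ : _ = pi' ((fun x => x - c) @^-1` ((fun x => x + c) @^-1` A)))//.
  congr (pi' _); apply/seteqP.
  by split => x /=; rewrite subrK.
- exact: (has_density_translation (fun A _ => lawE pi (measurable_addr c) A) dens).
Qed.

Lemma derive1_translation (f : R -> R) (c : R) :
  derive1 (fun x => f (x - c)) = (fun x => derive1 f (x - c)).
Proof.
apply/funext => x; rewrite /derive1.
rewrite (_ : (fun h : R => h^-1 *: (f (h + x - c) - f (x - c)))
  = (fun h : R => h^-1 *: (f (h + (x - c)) - f (x - c)))) //.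
by apply/funext => h; rewrite addrA.
Qed.

Lemma derive1n_translation (f : R -> R) (c : R) k :
  derive1n k (fun x => f (x - c)) = (fun x => derive1n k f (x - c)).
Proof.
elim: k => // k ih; rewrite !derive1nS ih; exact: derive1_translation.
Qed.

Lemma derivable_translation (f : R -> R) (c x v : R) :
  derivable f (x - c) v -> derivable (fun x => f (x - c)) x v.
Proof.
rewrite /derivable (_ : (fun h : R => h^-1 *: (f (h *: v + x - c) - f (x - c)))
  = (fun h : R => h^-1 *: (f (h *: v + (x - c)) - f (x - c)))) //.
by apply/funext => h; rewrite addrA.
Qed.

Lemma holder_class_translation (beta L c : R) (m : R -> R) : 0 < L ->
  holder_class beta L m -> holder_class beta (2 * L) (fun x => m (x - c)).
Proof.
move=> L0 [dm bm hm]; have L2 : L <= 2 * L by lra.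
split.
- by move=> k x kn; rewrite derive1n_translation; apply: derivable_translation; exact: dm.
- by move=> k x kn; rewrite derive1n_translation (le_trans (bm _ _ kn)).
- move=> t x; rewrite derive1n_translation addrAC (le_trans (hm _ _))//.
  by rewrite ler_wpM2r// powR_ge0.
Qed.

(** With [y = x - c], the term [c * b y] that separates [x * b y] from [y * b y] is
bounded. *)
Lemma mean_reverting_translation (b b' : R -> R) (c M : R) :
  (forall x, b' (x + c) = b x) -> (forall x, `|b x| <= M) ->
  mean_reverting b -> mean_reverting b'.
Proof.
move=> bb' bM [rho [c1 [c2 [rho0 c10 c20 Hb]]]].
have M0 : 0 <= M by exact: le_trans (bM 0).
exists (rho + `|c|), c1, (c2 + c1 * `|c| + `|c| * M); split => //.
- by rewrite ltr_wpDr.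
- by rewrite ltr_wpDr ?mulr_ge0// ltr_wpDr// mulr_ge0// ltW.
move=> x xr; rewrite -(subrK c x) bb'; set y := x - c.
have xy : `|x| <= `|y| + `|c| by rewrite -{1}(subrK c x) ler_normD.
have yx : `|y| <= `|y + c| + `|c|.
  by rewrite -{1}(addrK c y) ler_normB.
have yr : rho <= `|y| by lra.
have := Hb _ yr; rewrite (mulrDl y c).
have : c * b y <= `|c| * M.
  by rewrite (le_trans (ler_norm _))// normrM ler_wpM2l.
have : `|y + c| <= `|y| + `|c| by exact: ler_normD.
have : c1 * `|y + c| <= c1 * (`|y| + `|c|) by rewrite ler_wpM2l ?ler_normD// ltW.
lra.
Qed.

End translated_model.

(** * Regularity of the density and the two-point bound *)

Section density_regularity.
Context {R : realType}.
Local Notation leb := (@lebesgue_measure R).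

Lemma shift_loss_translation (m : R -> R) (c h : R) :
  measurable_fun setT m ->
  shift_loss (fun x => m (x - c)) h = shift_loss m h.
Proof.
move=> mm; rewrite /shift_loss.
rewrite -(ge0_integral_translation (- c) (f := fun u => (Num.max 0 (m u - m (u + h)))%:E)).
- by apply: eq_integral => u _; rewrite addrAC.
- apply/measurable_EFinP; apply: measurable_maxr => //.
  apply: measurable_funB => //; apply: (measurableT_comp mm).
  exact: measurable_addr.
- by move=> u; rewrite lee_fin le_max lexx.
Qed.

(** Along shifts tending to 0 the integrand tends to 0 by continuity and is
dominated by [m], so no sequence of shifts can contradict the claim. *)
Lemma shift_loss_small (pi : set R -> \bar R) (m : R -> R) (e : R) :
  pi setT = 1%E -> has_density pi m -> continuous m -> 0 < e ->
  exists2 h0, 0 < h0 & forall h, 0 < h -> h <= h0 -> (shift_loss m h <= e%:E)%E.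
Proof.
move=> pi1 [mm m0 dens] cm e0.
have im : leb.-integrable setT (EFin \o m).
  apply/integrableP; split; first exact/measurable_EFinP.
  have -> : (\int[leb]_x `|(EFin \o m) x| = \int[leb]_(x in setT) (m x)%:E)%E.
    by apply: eq_integral => x _; rewrite /= ger0_norm.
  by rewrite -dens// pi1 ltry.
apply: contrapT => nex.
have H n : exists h, [/\ 0 < h, h <= n.+1%:R^-1 & (e%:E < shift_loss m h)%E].
  apply: contrapT => nh; apply: nex; exists n.+1%:R^-1; first by rewrite invr_gt0.
  move=> h h0 hn; rewrite leNgt; apply/negP => he; apply: nh; by exists h.
have [hs Hs] := choice H.
have hs0 : hs @ \oo --> 0.
  apply: (squeeze_cvgr _ (cvg_cst 0) (@cvg_harmonic R)).
  by apply: nearW => n; have [h0 hn _] := Hs n; rewrite ltW.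
have mloss n : measurable_fun setT (fun u : R => Num.max 0 (m u - m (u + hs n))).
  apply: measurable_maxr => //; apply: measurable_funB => //.
  by apply: (measurableT_comp mm); exact: measurable_addr.
have [] := @dominated_convergence _ _ _ leb setT measurableT
  (fun n u => (Num.max 0 (m u - m (u + hs n)%R))%:E) (fun=> 0%E) (EFin \o m).
- by move=> n; apply/measurable_EFinP; exact: mloss.
- exact: measurable_cst.
- apply: aeW => u _; apply: cvg_EFin; first exact: nearW.
  rewrite [X in _ --> X](_ : 0 = Num.max 0 (m u - m u)); last by rewrite subrr maxxx.
  apply: cvg_maxr; first exact: cvg_cst.
  apply: cvgB; first exact: cvg_cst.
  apply: (@continuous_cvg _ _ _ _ _ (fun n => u + hs n) m); first exact: cm.
  rewrite -[X in _ --> X]addr0; apply: cvgD => //; exact: cvg_cst.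
- exact: im.
- apply: aeW => u n _; rewrite /= lee_fin ger0_norm ?le_max ?lexx//.
  by rewrite ge_max m0/= gerBl.
move=> _ _; rewrite integral0 => H0.
have {}H0 := H0 _ (@open_ereal_lt' _ _ e%:E _).
have /H0[N _ /(_ N (leqnn N))] : (0%R%:E < e%:E :> \bar R)%E by rewrite lte_fin.
by have [_ _ /lt_trans h] := Hs N => /h; rewrite ltxx.
Qed.

(** A constant has integral 0 or [+oo] over the line. *)
Lemma nonconstant_density (pi : set R -> \bar R) (m : R -> R) :
  pi setT = 1%E -> has_density pi m -> (forall x, derivable m x 1) ->
  exists y, derive1 m y != 0.
Proof.
move=> pi1 [mm m0 dens] dm; apply: contrapT => nex.
have d0 (x : R) : is_derive x (1 : R) m (0 : R).
  have d0 : derive1 m x = 0.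
    by apply/eqP; apply: contrapT => /negP h; apply: nex; exists x.
  by rewrite -d0 derive1E; apply: DeriveDef => //; exact: dm.
have mE x : m x = m 0 by exact: is_derive_0_is_cst.
have := dens _ (@measurableT _ _); rewrite pi1.
rewrite (eq_integral (cst (m 0)%:E)); last by move=> x _; rewrite /= mE.
rewrite integral_cst// [X in (_ * X)%E](_ : _ = +oo%E); last first.
  have := @lebesgue_measure_itv R `]-oo, +oo[; rewrite /= set_itvNyy; exact.
have := m0 0; rewrite le_eqVlt => /predU1P[<-|m00].
  by rewrite mul0e => -[] /eqP; rewrite oner_eq0.
by rewrite gt0_muley ?lte_fin.
Qed.

Lemma left_slope (m : R -> R) (y : R) : derivable m y 1 -> derive1 m y != 0 ->
  exists2 h0, 0 < h0 & forall h, 0 < h -> h <= h0 ->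
    `|derive1 m y| / 2 * h <= `|m y - m (y - h)|.
Proof.
move=> dm; set D := derive1 m y => D0.
have dm' : (fun h : R => h^-1 *: (m (h + y) - m y)) @ 0^' --> D.
  suff : cvg ((fun h : R => h^-1 *: (m (h + y) - m y)) @ 0^') by [].
  move: dm; rewrite /derivable.
  rewrite (_ : (fun h : R => h^-1 *: (m (h *: (1 : R) + y) - m y)) =
    (fun h : R => h^-1 *: (m (h + y) - m y))) //.
  by apply/funext => h; rewrite /GRing.scale/= mulr1.
have D2 : 0 < `|D| / 2 by rewrite divr_gt0// normr_gt0.
move/cvgrPdist_lt : dm' => /(_ _ D2) [r /= r0 Hr].
exists (r / 2); first by rewrite divr_gt0.
move=> h h0 hr.
have := Hr (- h); rewrite /= sub0r opprK gtr0_norm// => /(_ _ _).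
have hr' : h < r by lra.
rewrite hr' oppr_eq0 gt_eqF// => /(_ isT isT).
rewrite (addrC (- h)) => H.
have {}H := le_lt_trans (lerB_dist _ _) H.
have E : `|(- h)^-1 *: (m (y - h) - m y)| = `|m y - m (y - h)| / h.
  by rewrite normrM normfV normrN (gtr0_norm h0) mulrC distrC.
rewrite E in H; rewrite -ler_pdivlMr//; lra.
Qed.

End density_regularity.

Section two_points.
Context d (S : measurableType d) (R : realType).

(** Le Cam's two-point argument. If the estimator is often far from [m0] under [Q0],
its risk there is large. Otherwise, by the comparison of the laws, it is often
close to [m0] under [Q1] as well, hence far from [m1]. *)
Lemma two_point_bound (Q0 Q1 : probability S R) (est : S -> R) (m0 m1 C r : R) :
  measurable_fun setT est -> 1 <= C ->
  (forall A, measurable A -> (Q1 A <= (3 / 8)%:E + C%:E * Q0 A)%E) ->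
  r <= (m0 - m1) ^+ 2 / (32 * C) ->
  (r%:E <= \int[Q0]_w ((est w - m0) ^+ 2)%:E)%E \/
  (r%:E <= \int[Q1]_w ((est w - m1) ^+ 2)%:E)%E.
Proof.
move=> mest C1 H rle; set D := `|m0 - m1|.
have D2 : (m0 - m1) ^+ 2 = D ^+ 2 by rewrite /D real_normK ?num_real.
rewrite D2 in rle.
have C0 : 0 < C by lra.
pose A := [set w | D / 2 <= `|est w - m0|].
have mA : measurable A.
  have mf : measurable_fun setT (fun w => `|est w - m0|).
    by apply: measurableT_comp => //; exact: measurable_funB.
  have := mf measurableT `[D / 2, +oo[%classic (measurable_itv _).
  rewrite setTI; congr measurable.
  by apply/seteqP; split => w /=; rewrite in_itv/= andbT.
have risk_lb (Q : probability S R) (E : set S) m : measurable E ->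
    (forall w, E w -> D / 2 <= `|est w - m|) ->
    ((D ^+ 2 / 4)%:E * Q E <= \int[Q]_w ((est w - m) ^+ 2)%:E)%E.
  move=> mE HE.
  rewrite -(setIT E) -integral_indic// -ge0_integralZl//; last 2 first.
  - by apply/measurable_EFinP; exact: measurable_indic.
  - by rewrite lee_fin divr_ge0// sqr_ge0.
  apply: ge0_le_integral => //.
  - by move=> w _; rewrite -EFinM lee_fin mulr_ge0// divr_ge0// sqr_ge0.
  - apply: emeasurable_funM => //.
    by apply/measurable_EFinP; exact: measurable_indic.
  - apply/measurable_EFinP; apply: measurable_funX; exact: measurable_funB.
  - move=> w _; rewrite -EFinM lee_fin indicE.
    have [wE|wE] := boolP (w \in E); last by rewrite mulr0 sqr_ge0.
    rewrite mulr1 -(@real_normK _ (est w - m)) ?num_real//.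
    have -> : D ^+ 2 / 4 = (D / 2) ^+ 2 by field.
    have D20 : 0 <= D / 2 by rewrite divr_ge0// normr_ge0.
    by rewrite ler_sqr ?nnegrE//; exact: HE (set_mem wE).
have fQ (Q : probability S R) E : measurable E -> Q E = (fine (Q E))%:E.
  by move=> mE; rewrite fineK// fin_num_measure.
have D20 : 0 <= D ^+ 2 by exact: sqr_ge0.
have [pA|pA] := leP (1 / (8 * C))%:E (Q0 A).
- left; apply: le_trans (risk_lb Q0 A m0 mA _) => //.
  rewrite fQ// -EFinM lee_fin; rewrite fQ// lee_fin in pA.
  apply: (le_trans rle); rewrite (_ : D ^+ 2 / (32 * C) = D ^+ 2 / 4 * (1 / (8 * C))).
    by rewrite ler_wpM2l// divr_ge0.
  by field; rewrite gt_eqF.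
- right; have mCA : measurable (~` A) by exact: measurableC.
  apply: le_trans (risk_lb Q1 (~` A) m1 mCA _); last first.
    move=> w; rewrite /A /= => /negP; rewrite -ltNge => wA.
    have := ler_distD (est w) m0 m1; rewrite -/D (distrC m0 (est w)); lra.
  have := H _ mA; rewrite probability_setC//.
  rewrite (fQ Q1 A)// (fQ Q0 A)// -EFinM -!EFinD -EFinM !lee_fin => h.
  rewrite fQ// lte_fin in pA.
  set p0 := fine (Q0 A) in pA h; set p1 := fine (Q1 A) in h *.
  have Cp : C * p0 <= 1 / 8.
    rewrite (le_trans (ler_wpM2l (ltW C0) (ltW pA)))// le_eqVlt; apply/orP; left.
    by apply/eqP; field; rewrite gt_eqF.
  have p12 : 1 / 2 <= 1 - p1 by lra.
  apply: (le_trans rle); apply: (@le_trans _ _ (D ^+ 2 / 4 * (1 / 2))).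
    have -> : D ^+ 2 / 4 * (1 / 2) = D ^+ 2 / 8 by field.
    rewrite ler_wpM2l// lef_pV2 ?posrE ?mulr_gt0//; lra.
  by rewrite ler_wpM2l// divr_ge0.
Qed.

End two_points.

(** * The translates as a statistical family *)

Section drift_bounds.
Context {R : realType}.

Lemma lipschitz_constant (b : R -> R) : lipschitz b ->
  exists2 K, 0 <= K & forall u v, `|b u - b v| <= K * `|u - v|.
Proof.
move=> [K0 [_ HK]]; exists (Num.max 0 K0 + 1).
  by rewrite addr_ge0// le_max lexx.
move=> u v; have K1 : K0 < Num.max 0 K0 + 1 by rewrite ltr_pwDr// le_max lexx orbT.
by have := HK _ K1 (u, v); apply.
Qed.

Lemma bounded_constant (b : R -> R) : bounded_fun b ->
  exists2 M, 0 <= M & forall u, `|b u| <= M.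
Proof.
move=> [M0 [_ HM]]; exists (Num.max 0 M0 + 1).
  by rewrite addr_ge0// le_max lexx.
move=> u; have M1 : M0 < Num.max 0 M0 + 1 by rewrite ltr_pwDr// le_max lexx orbT.
by have := HM _ M1 u; apply.
Qed.

Lemma lipschitz_translation (b : R -> R) (c : R) : lipschitz b ->
  lipschitz (fun x => b (x - c)).
Proof.
move=> [K0 [rK HK]]; exists K0; split => // k Kk [u v] _ /=.
have := HK _ Kk (u - c, v - c); rewrite /= => /(_ (conj I I)).
by rewrite (_ : u - c - (v - c) = u - v)//; ring.
Qed.

Lemma bounded_translation (b : R -> R) (c : R) : bounded_fun b ->
  bounded_fun (fun x => b (x - c)).
Proof. by move=> [M0 [rM HM]]; exists M0; split => // k Mk u _; exact: HM. Qed.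

End drift_bounds.

Section translated_laws.
Context (R : realType) (a gamma beta L T : R) (F b m : R -> R).
Context d (Om : measurableType d) (P : probability Om R)
  (B : R -> Om -> R) (nu : Om -> {measure set (R * R) -> \bar R})
  (X : Om -> cadlag_path R).
Hypotheses (b_bnd : bounded_fun b) (b_lip : lipschitz b)
  (b_mr : mean_reverting b) (sol : solution a gamma F b P B nu X)
  (m_inv : unique_invariant_density a gamma F b m)
  (X_stat : has_density (marginal P X 0) m)
  (m_holder : holder_class beta L m) (L0 : 0 < L).

Lemma drift_class_translation c :
  drift_class a gamma F beta L (fun x => b (x - c)) (fun x => m (x - c)).
Proof.
have bb' x : (fun x => b (x - c)) (x + c) = b x by rewrite /= addrK.
have [M _ bM] := bounded_constant b_bnd.
split.
- exact: bounded_translation.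
- exact: lipschitz_translation.
- exact: (mean_reverting_translation bb' bM).
- exact: (unique_invariant_density_translation bb').
- exact: holder_class_translation.
Qed.

Lemma solution_shift c :
  solution a gamma F (fun x => b (x - c)) P B nu (fun w => shift_path c (X w)).
Proof. by apply: solution_translation sol => x; rewrite addrK. Qed.

Lemma density_shift c :
  has_density (marginal P (fun w => shift_path c (X w)) 0) (fun x => m (x - c)).
Proof. exact: (has_density_translation _ X_stat). Qed.

Lemma measurable_shift c :
  measurable_fun setT (fun w => shift_path c (X w) : observed_path T).
Proof.
have sI := @sigma_algebra_image _ _ setT
  (fun w => shift_path c (X w) : observed_path T) _ (sigma_algebra_measurable Om).
move=> _ A mA; apply: (smallest_sub sI _ mA); apply: (smallest_sub sI).
move=> _ [t /= /andP[t0 _] [C mC <-]]; rewrite /image_set_system/= setTI.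
case: sol => _ _ mX _ _.
have mXc : measurable_fun setT (fun w => path_at t (X w) + c).
  by apply: measurable_funD => //; exact: mX.
exact: (mXc measurableT _ mC).
Qed.

Lemma stationary_law_shift c :
  stationary_law a gamma F (fun x => b (x - c)) (fun x => m (x - c))
    (law P (measurable_shift c)).
Proof.
exists d, Om, P, B, nu, (fun w => shift_path c (X w)); split.
- exact: solution_shift.
- exact: density_shift.
- by [].
Qed.

(** The comparison between a solution and its translate by [h], applied to the
solution translated by [c]. *)
Lemma law_comparison (K M e c h : R) :
  0 < T -> 0 <= K -> 0 <= M -> a != 0 ->
  (forall u v, `|b u - b v| <= K * `|u - v|) -> (forall u, `|b u| <= M) ->
  (shift_loss m h <= e%:E)%E ->
  forall A, measurable A ->
  (law P (measurable_shift (c + h)) A <= (e + 1 / 4)%:E +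
   (expR ((K * `|h| / `|a|) ^+ 2 * T))%:E * law P (measurable_shift c) A)%E.
Proof.
move=> T0 K0 M0 a0 Kb Mb losse A mA.
have mm : measurable_fun setT m by case: X_stat.
apply: (@cylinder_transfer _ _ _ P T _ _ (ltW T0) (measurable_shift c)
  (measurable_shift (c + h)) (e + 1 / 4) _ _ _ A mA); first exact: expR_ge0.
move=> g cg.
have := @cylinder_inequality _ _ _ P T K M a gamma h F (fun x => b (x - c))
  (fun x => m (x - c)) B nu (fun w => shift_path c (X w)) T0 K0 M0 a0 _ _
  (solution_shift c) (density_shift c) e g.
rewrite shift_loss_translation// => H.
apply: le_trans (H _ _ losse cg).
- rewrite le_eqVlt; apply/orP; left; apply/eqP.
  apply: eq_integral => w _; congr (g _)%:E; apply/funext => t.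
  by rewrite !path_at_shift addrA.
- move=> u v; rewrite (le_trans (Kb _ _))// (_ : u - c - (v - c) = u - v)//; ring.
- by move=> u; exact: Mb.
Qed.

End translated_laws.

Lemma derivable_continuous (R : realType) (m : R -> R) :
  (forall x, derivable m x 1) -> continuous m.
Proof.
by move=> dm x; apply: differentiable_continuous; exact/derivable1_diffP.
Qed.

(** * The minimax lower bound *)

Theorem theorem3 (R : realType) (a gamma alpha beta L : R)
  (F b mu : R -> R)
  (d : measure_display) (Om : measurableType d) (P : probability Om R)
  (B : R -> Om -> R) (nu : Om -> {measure set (R * R) -> \bar R})
  (X : Om -> cadlag_path R)
  (F_levy : levy_density F)
  (A1_drift : bounded_fun b /\ lipschitz b)
  (A1_coef : a != 0 /\ 0 < gamma)
  (A2 : mean_reverting b)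
  (A3_alpha : 0 < alpha < 2)
  (A3 : full_support F /\ stable_domination alpha F)
  (A4 : exponential_moment F)
  (A5 : alpha = 1 -> centered_annuli F)
  (F_finite : (\int[lebesgue_measure]_(z in [set z | z != 0%R]) (F z)%:E
                 < +oo)%E)
  (X_sol : solution a gamma F b P B nu X)
  (mu_inv : unique_invariant_density a gamma F b mu)
  (X_stat : has_density (marginal P X 0) mu)
  (mu_holder : holder_class beta L mu)
  (beta_ge1 : 1 <= beta) (L_gt0 : 0 < L) :
  exists T0 c : R, [/\ 0 < T0, 0 < c &
    forall T, T0 <= T ->
      ((c / T)%:E <=
         ereal_inf [set minimax_risk a gamma F beta L T x | x in setT])%E].
Proof.
have [b_bnd b_lip] := A1_drift; have [a0 gamma0] := A1_coef.
have [K K0 Kb] := lipschitz_constant b_lip.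
have [M M0 Mb] := bounded_constant b_bnd.
have n1 : (0 < Num.truncn beta)%N by rewrite truncn_gt0.
have dmu x : derivable mu x 1.
  by have [dm _ _] := mu_holder; exact: (dm 0%N x n1).
have cmu := derivable_continuous dmu.
have PT : marginal P X 0 setT = 1%E by rewrite /marginal/= probability_setT.
have [y Dy] := nonconstant_density PT X_stat dmu.
have e8 : (0 : R) < 1 / 8 by [].
have [h0 h00 loss] := shift_loss_small PT X_stat cmu e8.
have [h1 h10 slope] := left_slope (dmu y) Dy.
set D := derive1 mu y in Dy slope.
pose C := expR (K ^+ 2 / a ^+ 2).
have C1 : 1 <= C by rewrite /C -expR0 ler_expR divr_ge0// sqr_ge0.
pose hm := Num.min h0 h1.
have hm0 : 0 < hm by rewrite lt_min h00.
(* T >= hm ^- 2 ensures that 1 / sqrt T <= hm *)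
exists (hm ^- 2), (D ^+ 2 / (128 * C)); split.
- by rewrite invr_gt0 exprn_gt0.
- by rewrite divr_gt0// ?exprn_even_gt0//= mulr_gt0// (lt_le_trans ltr01).
move=> T TT0.
have T0 : 0 < T by rewrite (lt_le_trans _ TT0)// invr_gt0 exprn_gt0.
pose h := (Num.sqrt T)^-1.
have hgt0 : 0 < h by rewrite invr_gt0 sqrtr_gt0.
have h2 : h ^+ 2 = T^-1 by rewrite /h exprVn sqr_sqrtr// ltW.
have hhm : h <= hm.
  rewrite -ler_sqr ?nnegrE ?(ltW hgt0) ?(ltW hm0)// h2 -[leRHS]invrK.
  by rewrite lef_pV2 ?posrE// invr_gt0 exprn_gt0.
have hh0 : h <= h0 by rewrite (le_trans hhm)// ge_min lexx.
have hh1 : h <= h1 by rewrite (le_trans hhm)// ge_min lexx orbT.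
apply: le_ereal_inf_tmp => _ [x _ <-]; apply: le_ereal_inf_tmp => _ [est mest <-].
(* the translation by c brings the point y to x *)
pose c := x - y.
pose Q0 := law P (measurable_shift (T := T) X_sol c).
pose Q1 := law P (measurable_shift (T := T) X_sol (c + h)).
have CE : (K * `|h| / `|a|) ^+ 2 * T = K ^+ 2 / a ^+ 2.
  rewrite !exprMn exprVn !real_normK ?num_real// h2.
  by field; rewrite a0 gt_eqF.
have Q10 A : measurable A -> (Q1 A <= (3 / 8)%:E + C%:E * Q0 A)%E.
  move=> mA.
  have := law_comparison X_sol X_stat c T0 K0 M0 a0 Kb Mb (loss h hgt0 hh0) mA.
  by rewrite CE (_ : 1 / 8 + 1 / 4 = 3 / 8 :> R)//; field.
have rle : D ^+ 2 / (128 * C) / T <= (mu (x - c) - mu (x - (c + h))) ^+ 2 / (32 * C).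
  have -> : x - c = y by rewrite /c; ring.
  have -> : x - (c + h) = y - h by rewrite /c; ring.
  have sl := slope h hgt0 hh1.
  have : (`|D| / 2 * h) ^+ 2 <= (mu y - mu (y - h)) ^+ 2.
    rewrite -[leRHS]real_normK ?num_real// ler_sqr ?nnegrE//.
    by rewrite mulr_ge0 ?divr_ge0// ltW.
  rewrite !exprMn h2 real_normK ?num_real// => Dle.
  have -> : D ^+ 2 / (128 * C) / T = D ^+ 2 * 2^-1 ^+ 2 * T^-1 / (32 * C).
    by field; rewrite !gt_eqF// (lt_le_trans ltr01).
  by rewrite ler_wpM2r// invr_ge0 mulr_ge0// (le_trans ler01).
have class0 := drift_class_translation b_bnd b_lip A2 mu_inv mu_holder L_gt0.
have law0 := stationary_law_shift T X_sol X_stat.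
have [r0|r1] := two_point_bound mest C1 Q10 rle.
- apply: (le_trans r0); apply: ereal_sup_ubound.
  by exists (fun z => b (z - c)), (fun z => mu (z - c)), Q0; split.
- apply: (le_trans r1); apply: ereal_sup_ubound.
  by exists (fun z => b (z - (c + h))), (fun z => mu (z - (c + h))), Q1; split.
Qed.
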